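(* Let $\mathcal{X}$ be a set, $(\Omega,\mathcal{A},\mu)$ a measure space, and $d\in\mathbb{N}\cup\{\infty\}$. For each $\omega\in\Omega$ let $\mathcal{H}_\omega$ be a reproducing kernel Hilbert space over $\mathcal{X}$ of dimension $d$, with reproducing kernel $K_\omega$, and let $E_\omega:\mathcal{H}_\omega\to\mathbb{C}^d$ be the isometries defining the measurable structure. Assume that for every $x\in\mathcal{X}$ the cross-section $(K_\omega(\cdot,x))_{\omega\in\Omega}$ is measurable and $\int_\Omega K_\omega(x,x)\,d\mu(\omega)<\infty$. Let $\mathcal{H}$ be the reproducing kernel Hilbert space over $\mathcal{X}$ with reproducing kernel $K(x,y)=\int_\Omega K_\omega(x,y)\,d\mu(\omega)$; it equals $\{\int_\Omega f_\omega\,d\mu(\omega) : (f_\omega)_{\omega\in\Omega}\in\tilde{\mathcal{H}}\}$, where $\tilde{\mathcal{H}}$ is the direct integral of the $\mathcal{H}_\omega$. Assume moreover that there is a sequence of points $y_n\in\mathcal{X}$, $n\in\mathbb{N}$, such that $\{\omega\mapsto E_\omega K_\omega(\cdot,y_n)\}_{n\in\mathbb{N}}$ forms a complete orthogonal set of $L_2(\Omega\to\mathbb{C}^d,\mu)$. Then $\{K(\cdot,y_n)\}_{n\in\mathbb{N}}$ forms a complete orthogonal set in $\mathcal{H}$; in particular $$g(x)=\sum_{n\in\mathbb{N}}g(y_n)\,\frac{K(x,y_n)}{K(y_n,y_n)}$$ for all $g\in\mathcal{H}$ and $x\in\mathcal{X}$.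
   Context: A reproducing kernel Hilbert space over $\mathcal{X}$ with reproducing kernel $K$ is a Hilbert space $\mathcal{H}$ of functions $\mathcal{X}\to\mathbb{C}$ with $K(\cdot,y)\in\mathcal{H}$ and $f(y)=\langle f,K(\cdot,y)\rangle$ for all $f\in\mathcal{H}$, $y\in\mathcal{X}$ (scalar products are linear in the first argument). $\mathbb{C}^\infty$ denotes $\ell_2(\mathbb{C})$. The measurable structure consists of a linear isometry $E_\omega:\mathcal{H}_\omega\to\mathbb{C}^d$ for each $\omega\in\Omega$. A cross-section is a family $f=(f_\omega)_{\omega\in\Omega}$ with $f_\omega\in\mathcal{H}_\omega$; it is measurable if $\omega\mapsto E_\omega f_\omega$, $\Omega\to\mathbb{C}^d$, is measurable. The direct integral $\tilde{\mathcal{H}}$ is the Hilbert space of measurable cross-sections $f$ with $\int_\Omega\|f_\omega\|_\omega^2\,d\mu(\omega)<\infty$ (with $f,g$ identified if $\int_\Omega\|f_\omega-g_\omega\|_\omega^2\,d\mu(\omega)=0$), with scalar product $\langle f,g\rangle_\sim=\int_\Omega\langle f_\omega,g_\omega\rangle_\omega\,d\mu(\omega)$. Integrals $\int_\Omega f_\omega\,d\mu(\omega)$ are taken pointwise on $\mathcal{X}$. $L_2(\Omega\to\mathbb{C}^d,\mu)$ is the Hilbert space of (classes of) measurable square-integrable functions $\Omega\to\mathbb{C}^d$. A family $\{v_n\}_{n\in\mathbb{N}}$ in a Hilbert space is a complete orthogonal set if its members are nonzero, pairwise orthogonal for distinct indices, and only the zero vector is orthogonal to all of them. *)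

(* Defs.v *)
From HB Require Import structures.
From mathcomp Require Import all_boot all_order all_algebra.
From mathcomp Require Import complex.
From mathcomp Require Import all_classical all_reals all_analysis.

Set Implicit Arguments.
Unset Strict Implicit.
Unset Printing Implicit Defensive.

Import Order.TTheory GRing.Theory Num.Theory.
Import numFieldNormedType.Exports.

Local Open Scope classical_set_scope.
Local Open Scope ring_scope.

(* The alias R[i]^o, rather than R[i], is the one on which the library puts
   the topology given by the modulus. *)
Notation Cplx R := (R[i]^o).

Section Hilbert.
Context {R : realType} {V : lmodType R[i]}.
Implicit Types (D Z : set V) (dot : V -> V -> Cplx R).

Definition dot_norm dot (u : V) : R := Num.sqrt (complex.Re (dot u u)).

(* A Hilbert space whose vectors form a linear subspace of V; the values of
   hdot outside hcar are irrelevant. *)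
Record hilbert := Hilbert {
  hcar : set V ;
  hdot : V -> V -> Cplx R ;
  hcar0 : hcar 0 ;
  hcar_lin : forall (a : Cplx R) u v, hcar u -> hcar v -> hcar (a *: u + v) ;
  hdot_linl : forall (a : Cplx R) u v w, hcar u -> hcar v -> hcar w ->
    hdot (a *: u + v) w = a * hdot u w + hdot v w ;
  hdot_conj : forall u v, hcar u -> hcar v -> hdot v u = (hdot u v)^* ;
  hdot_ge0 : forall u, hcar u -> 0 <= hdot u u ;
  hdot_eq0 : forall u, hcar u -> hdot u u = 0 -> u = 0 ;
  hcomplete : forall u_ : nat -> V, (forall n, hcar (u_ n)) ->
    (forall e : R, 0 < e -> exists N : nat, forall m n : nat,
       (N <= m)%N -> (N <= n)%N -> dot_norm hdot (u_ m - u_ n) < e) ->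
    exists2 l, hcar l & dot_norm hdot (u_ n - l) @[n --> \oo] --> (0 : R) }.

(* Z is the set of vectors that count as zero: {0} in a genuine Hilbert space
   of functions, the almost everywhere null functions in an L2 space whose
   elements are handled through representatives. *)
Definition complete_orthogonal_set D Z dot (v : nat -> V) :=
  [/\ forall n, D (v n),
      forall n, ~ Z (v n),
      forall m n, m <> n -> dot (v m) (v n) = 0 &
      forall u, D u -> (forall n, dot u (v n) = 0) -> Z u].

(* None stands for the dimension oo; the coordinates are indexed by k < d. *)
Definition coord (d : option nat) (k : nat) : bool :=
  if d is Some n then (k < n)%N else true.

Definition hilbert_dim (H : hilbert) (d : option nat) :=
  exists e : nat -> V,
    [/\ forall k, coord d k -> hcar H (e k),
        forall j k, coord d j -> coord d k ->
          hdot H (e j) (e k) = (j == k)%:R &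
        forall u, hcar H u -> (forall k, coord d k -> hdot H u (e k) = 0) ->
          u = 0].

End Hilbert.
Arguments hilbert {R} V.

Definition reproducing_kernel (R : realType) (X : Type)
    (H : hilbert (X -> Cplx R)) (K : X -> X -> Cplx R) :=
  forall y, hcar H (K^~ y) /\
    forall f, hcar H f -> f y = hdot H f (K^~ y).

Section CoordinateSpace.
Context {R : realType}.
Variable d : option nat.

(* C^d as the space of square-summable complex sequences vanishing outside
   the coordinates k < d, so that C^oo is l2. *)
Definition Cd : set (nat -> Cplx R) :=
  [set u | (forall k, ~~ coord d k -> u k = 0) /\
     (\sum_(0 <= k <oo) (complex.Re (`|u k| ^+ 2))%:E < +oo)%E].

Definition Cd_dot (u v : nat -> Cplx R) : Cplx R :=
  limn (series (fun k => u k * (v k)^* : Cplx R)).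

Definition Cd_norm := dot_norm Cd_dot.

Definition Cd_open : set (set (nat -> Cplx R)) :=
  [set U | U `<=` Cd /\ forall u, U u ->
     exists2 e : R, 0 < e & forall v, Cd v -> Cd_norm (v - u) < e -> U v].

Definition Cd_measurable (disp : measure_display)
    (Omega : measurableType disp) (f : Omega -> nat -> Cplx R) :=
  (forall w, Cd (f w)) /\
  measurable_fun [set: Omega] (f : Omega -> g_sigma_algebraType Cd_open).

Definition linear_isometry_Cd (V : lmodType R[i]) (H : hilbert V)
    (E : V -> nat -> Cplx R) :=
  [/\ forall u, hcar H u -> Cd (E u),
      forall (a : Cplx R) u v, hcar H u -> hcar H v ->
        E (a *: u + v) = a *: E u + E v &
      forall u, hcar H u -> Cd_norm (E u) = dot_norm (hdot H) u].

End CoordinateSpace.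

Section Integration.
Context {R : realType} {disp : measure_display} {Omega : measurableType disp}.
Variable mu : {measure set Omega -> \bar R}.

Definition cintegral (f : Omega -> Cplx R) : Cplx R :=
  Complex (\int[mu]_w complex.Re (f w)) (\int[mu]_w complex.Im (f w)).

Variable d : option nat.

Definition L2_Cd : set (Omega -> nat -> Cplx R) :=
  [set f | Cd_measurable d f /\
     (\int[mu]_w (Cd_norm (f w) ^+ 2)%:E < +oo)%E].

Definition L2_Cd_dot (f g : Omega -> nat -> Cplx R) : Cplx R :=
  cintegral (fun w => Cd_dot (f w) (g w)).

Definition L2_Cd_null : set (Omega -> nat -> Cplx R) :=
  [set f | {ae mu, forall w, f w = 0}].

Context {X : Type}.
Variables (H_ : Omega -> hilbert (X -> Cplx R))
          (E : Omega -> (X -> Cplx R) -> nat -> Cplx R).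

Definition cross_section (f : Omega -> X -> Cplx R) :=
  forall w, hcar (H_ w) (f w).

Definition measurable_cross_section (f : Omega -> X -> Cplx R) :=
  cross_section f /\ Cd_measurable d (fun w => E w (f w)).

(* The elements of the direct integral, without passing to classes: the
   functions \int f_w dmu(w) do not depend on the representative. *)
Definition direct_integral : set (Omega -> X -> Cplx R) :=
  [set f | measurable_cross_section f /\
     (\int[mu]_w (dot_norm (hdot (H_ w)) (f w) ^+ 2)%:E < +oo)%E].

End Integration.

(* Main.v *)
Require Import Defs.
From HB Require Import structures.
From mathcomp Require Import all_boot all_order all_algebra.
From mathcomp Require Import complex.
From mathcomp Require Import all_classical all_reals all_analysis.
From mathcomp Require Import measurable_realfun.
From mathcomp Require Import ring lra.

Set Implicit Arguments.
Unset Strict Implicit.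
Unset Printing Implicit Defensive.

Import Order.TTheory GRing.Theory Num.Theory.
Import numFieldNormedType.Exports.

Local Open Scope classical_set_scope.
Local Open Scope ring_scope.

(** Write [kap x] for the cross-section [w |-> K_w(., x)]. The reproducing
    property in the fibres gives, for every [f] in the direct integral,
    [<f, kap x> = \int f_w(x) dmu(w)]; in particular
    [<kap x, kap z> = K z x = <K(., x), K(., z)>], so that the families [kap] in
    the direct integral and [K(., x)] in the space [H] have the same Gram
    matrix. Since each [E_w] preserves inner products, the hypothesis on the
    maps [w |-> E_w K_w(., y_n)] says that the [kap (y n)] are nonzero and
    orthogonal, and that only null cross-sections are orthogonal to all of them.

    The direct integral is complete (a Riesz-Fischer theorem,
    [direct_integral_complete]), hence every one of its elements is the sum of
    its Fourier series along the [kap (y n)] ([fourier_series_cvg]). Because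
    norms of linear combinations only depend on the Gram matrix, a convergent
    series of [kap (y n)] becomes, with the same coefficients, a convergent
    series of [K(., y_n)] in [H], and conversely ([gram_transfer]); the two limits
    have the same products with [kap x] and [K(., x)], which means that the
    limit in [H] is the function [x |-> \int f_w(x) dmu(w)] attached to the limit
    [f] in the direct integral.

    Applied to the expansion of [kap x], this shows that [K(., x)] is the sum of
    a series of multiples of the [K(., y_n)], so that a function of [H]
    orthogonal to all of these vanishes at [x]: the [K(., y_n)] are complete. The
    sampling formula is then the value at [x] of the Fourier expansion in [H].
    Applied to the expansions of arbitrary elements, in one direction and in the
    other, it identifies [H] with the set of the integrals of elements of the
    direct integral.

    What remains is to see that the direct integral is an inner product space.
    Closure under sums and limits requires that measurability for the Borel
    sets of the coordinate space be measurability of each coordinate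
    ([Cd_measurableP]), a consequence of separability. Elements are handled
    through representatives, so the inner product there is only semidefinite. *)

(** * Complex numbers through their real and imaginary parts *)

Section ComplexParts.
Context {R : realType}.
Implicit Types (z t a b : Cplx R).

Lemma complex_eq z t :
  complex.Re z = complex.Re t -> complex.Im z = complex.Im t -> z = t.
Proof. by case: z t => [a b] [c e] /= -> ->. Qed.

Lemma ReD z t : complex.Re (z + t) = complex.Re z + complex.Re t.
Proof. by case: z t => [a b] [c e]. Qed.

Lemma ImD z t : complex.Im (z + t) = complex.Im z + complex.Im t.
Proof. by case: z t => [a b] [c e]. Qed.

Lemma ReN z : complex.Re (- z) = - complex.Re z.
Proof. by case: z. Qed.

Lemma ImN z : complex.Im (- z) = - complex.Im z.
Proof. by case: z. Qed.

Lemma ReM z t : complex.Re (z * t) =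
  complex.Re z * complex.Re t - complex.Im z * complex.Im t.
Proof. by case: z t => [a b] [c e]. Qed.

Lemma ImM z t : complex.Im (z * t) =
  complex.Re z * complex.Im t + complex.Im z * complex.Re t.
Proof. by case: z t => [a b] [c e]. Qed.

Lemma ReJ z : complex.Re z^* = complex.Re z.
Proof. by case: z. Qed.

Lemma ImJ z : complex.Im z^* = - complex.Im z.
Proof. by case: z. Qed.

Definition partsE := (ReD, ImD, ReN, ImN, ReM, ImM, ReJ, ImJ).

Definition sqmod z : R := complex.Re z ^+ 2 + complex.Im z ^+ 2.

Lemma sqmod_ge0 z : 0 <= sqmod z.
Proof. by rewrite addr_ge0 ?sqr_ge0. Qed.

Lemma Re_sqr_norm z : complex.Re (`|z| ^+ 2) = sqmod z.
Proof.
by rewrite -[`|z| ^+ 2]/((`|z : R[i]| ^+ 2) : R[i]) -add_Re2_Im2.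
Qed.

Lemma mulc_conj z : z * z^* = Complex (sqmod z) 0.
Proof. apply: complex_eq; rewrite !partsE /= /sqmod; ring. Qed.

Lemma ge0_complexP z : 0 <= z <-> 0 <= complex.Re z /\ complex.Im z = 0.
Proof.
rewrite -[_ <= _]/((0 : R[i]) <= (z : R[i])) lecE /=; split.
  by move=> /andP[/eqP -> ->].
by move=> [-> ->]; rewrite eqxx.
Qed.

Lemma norm_complex_le z : `|z| <= Complex (`|complex.Re z| + `|complex.Im z|) 0.
Proof.
rewrite -[_ <= _]/((`|z : R[i]| : R[i]) <= _).
rewrite normc_def lecE /= eqxx /=.
rewrite -[leRHS]ger0_norm ?addr_ge0// -sqrtr_sqr ler_wsqrtr//.
rewrite sqrrD !real_normK ?num_real// addrAC lerDl.
by rewrite mulrn_wge0 // mulr_ge0.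
Qed.

Lemma norm_Re_le z : Complex `|complex.Re z| 0 <= `|z| :> Cplx R.
Proof. exact: normc_ge_Re. Qed.

Lemma norm_Im_le z : Complex `|complex.Im z| 0 <= `|z| :> Cplx R.
Proof.
rewrite -[_ <= _]/(_ <= (`|z : R[i]| : R[i])).
rewrite normc_def lecE /= eqxx /= -sqrtr_sqr ler_wsqrtr//.
by rewrite lerDr sqr_ge0.
Qed.

Lemma cvg_complex (z_ : nat -> Cplx R) z :
  (fun n => complex.Re (z_ n)) @ \oo --> complex.Re z ->
  (fun n => complex.Im (z_ n)) @ \oo --> complex.Im z ->
  z_ @ \oo --> z.
Proof.
move=> hr hi; apply/cvgrPdist_lt => e.
rewrite -[0 < e]/((0 : R[i]) < (e : R[i])) ltcE => /= /andP[/eqP e0 e_gt0].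
have e2 : 0 < complex.Re e / 2 by rewrite divr_gt0.
move/cvgrPdist_lt/(_ _ e2): hr => hr; move/cvgrPdist_lt/(_ _ e2): hi => hi.
near=> n; apply: (le_lt_trans (norm_complex_le _)).
rewrite -[_ < _]/((_ : R[i]) < (e : R[i])) ltcE /= e0 eqxx /=.
rewrite !partsE (splitr (complex.Re e)) ltrD //; near: n; assumption.
Unshelve. all: by end_near. Qed.

Lemma sqmodD_le a b : sqmod (a + b) <= 2 * sqmod a + 2 * sqmod b :> R.
Proof.
rewrite /sqmod !partsE.
have := sqr_ge0 (complex.Re a - complex.Re b).
have := sqr_ge0 (complex.Im a - complex.Im b).
nra.
Qed.

Lemma sqmodM a b : sqmod (a * b) = sqmod a * sqmod b :> R.
Proof. by rewrite /sqmod !partsE; ring. Qed.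

Lemma Re_sum (I : Type) (r : seq I) (F : I -> Cplx R) :
  complex.Re (\sum_(i <- r) F i) = \sum_(i <- r) complex.Re (F i).
Proof. by elim/big_rec2: _ => // i x y _ <-; rewrite ReD. Qed.

Lemma Im_sum (I : Type) (r : seq I) (F : I -> Cplx R) :
  complex.Im (\sum_(i <- r) F i) = \sum_(i <- r) complex.Im (F i).
Proof. by elim/big_rec2: _ => // i x y _ <-; rewrite ImD. Qed.

Lemma normr_parts_conj_le a b :
  `|complex.Re (a * b^*)| <= sqmod a + sqmod b /\
  `|complex.Im (a * b^*)| <= sqmod a + sqmod b.
Proof.
rewrite /sqmod !partsE; case: a b => [a1 a2] [b1 b2] /=.
have := sqr_ge0 (a1 - b1); have := sqr_ge0 (a2 - b2).
have := sqr_ge0 (a1 + b1); have := sqr_ge0 (a2 + b2).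
have := sqr_ge0 (a1 - b2); have := sqr_ge0 (a2 - b1).
have := sqr_ge0 (a1 + b2); have := sqr_ge0 (a2 + b1).
by split; rewrite ler_norml; apply/andP; split; nra.
Qed.

Lemma cvg_parts (z_ : nat -> Cplx R) (z : Cplx R) : z_ @ \oo --> z ->
  (fun n => complex.Re (z_ n)) @ \oo --> complex.Re z /\
  (fun n => complex.Im (z_ n)) @ \oo --> complex.Im z.
Proof.
move=> /cvgrPdist_lt h; split; apply/cvgrPdist_lt => e e0;
  have := h (Complex e 0); rewrite -[0 < _]/((0 : R[i]) < _) ltcE /= eqxx e0;
  move=> /(_ isT); apply: filterS => n hn.
  have := le_lt_trans (norm_Re_le _) hn.
  by rewrite -[_ < _]/((_ : R[i]) < _) ltcE /= eqxx !partsE.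
have := le_lt_trans (norm_Im_le _) hn.
by rewrite -[_ < _]/((_ : R[i]) < _) ltcE /= eqxx !partsE.
Qed.

End ComplexParts.

(** * Spaces with a positive semidefinite inner product *)

(** Definiteness is left out so that the notion covers spaces of representatives,
    such as the cross-sections of a direct integral. *)
Record inner_product {R : realType} {V : lmodType R[i]} (D : set V)
    (dot : V -> V -> Cplx R) : Prop := InnerProduct {
  ip0 : D 0 ;
  ip_lin : forall (a : Cplx R) u v, D u -> D v -> D (a *: u + v) ;
  ip_linl : forall (a : Cplx R) u v w, D u -> D v -> D w ->
    dot (a *: u + v) w = a * dot u w + dot v w ;
  ip_conj : forall u v, D u -> D v -> dot v u = (dot u v)^* ;
  ip_ge0 : forall u, D u -> 0 <= dot u u }.

Lemma hilbert_inner_product (R : realType) (V : lmodType R[i])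
  (H : hilbert V) : inner_product (hcar H) (hdot H).
Proof.
split; [exact: hcar0|exact: hcar_lin|exact: hdot_linl|exact: hdot_conj|].
exact: hdot_ge0.
Qed.

Section InnerProduct.
Context {R : realType} {V : lmodType R[i]} {D : set V} {dot : V -> V -> Cplx R}.
Hypothesis ip : inner_product D dot.
Implicit Types (u v w : V) (a : Cplx R).

Local Notation rdot u v := (complex.Re (dot u v)).
Local Notation N := (dot_norm dot).

Lemma ipD u v : D u -> D v -> D (u + v).
Proof. by move=> Du Dv; have := ip_lin ip 1 Du Dv; rewrite scale1r. Qed.

Lemma ipZ a u : D u -> D (a *: u).
Proof. by move=> Du; have := ip_lin ip a Du (ip0 ip); rewrite addr0. Qed.

Lemma ipN u : D u -> D (- u).
Proof. by move=> Du; rewrite -scaleN1r; apply: ipZ. Qed.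

Lemma ipB u v : D u -> D v -> D (u - v).
Proof. by move=> Du Dv; apply: ipD => //; apply: ipN. Qed.

Lemma ip_sum (I : Type) (r : seq I) (F : I -> V) :
  (forall i, D (F i)) -> D (\sum_(i <- r) F i).
Proof.
move=> DF; elim: r => [|i r IH]; first by rewrite big_nil; exact: (ip0 ip).
by rewrite big_cons; exact: ipD (DF i) IH.
Qed.

Lemma dotDl u v w : D u -> D v -> D w -> dot (u + v) w = dot u w + dot v w.
Proof.
by move=> Du Dv Dw; rewrite -[u in LHS]scale1r (ip_linl ip)// mul1r.
Qed.

Lemma dot0l w : D w -> dot 0 w = 0.
Proof.
move=> Dw; have D0 := ip0 ip; have := dotDl D0 D0 Dw; rewrite addr0.
by move/eqP; rewrite -[X in X == _]addr0 => /eqP/addrI.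
Qed.

Lemma dotZl a u w : D u -> D w -> dot (a *: u) w = a * dot u w.
Proof.
by move=> Du Dw; rewrite -[_ *: _]addr0 (ip_linl ip)//;
  [rewrite dot0l ?addr0|exact: (ip0 ip)].
Qed.

Lemma dotNl u w : D u -> D w -> dot (- u) w = - dot u w.
Proof. by move=> Du Dw; rewrite -scaleN1r dotZl// mulN1r. Qed.

Lemma dotBl u v w : D u -> D v -> D w -> dot (u - v) w = dot u w - dot v w.
Proof. by move=> Du Dv Dw; rewrite dotDl ?dotNl//; exact: ipN. Qed.

Lemma dot_suml (I : Type) (r : seq I) (F : I -> V) w :
  (forall i, D (F i)) -> D w ->
  dot (\sum_(i <- r) F i) w = \sum_(i <- r) dot (F i) w.
Proof.
move=> DF Dw; elim: r => [|i r IH]; first by rewrite !big_nil dot0l.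
by rewrite !big_cons dotDl ?IH//; exact: ip_sum.
Qed.

Lemma dotZr a u w : D u -> D w -> dot w (a *: u) = a^* * dot w u.
Proof.
move=> Du Dw; rewrite (ip_conj ip (ipZ a Du) Dw) dotZl//.
by rewrite (ip_conj ip Du Dw) rmorphM.
Qed.

Lemma rdotC u v : D u -> D v -> rdot u v = rdot v u.
Proof. by move=> Du Dv; rewrite (ip_conj ip Du Dv) partsE. Qed.

(** The imaginary part of the inner product is a real part as well, so that
    estimates need only be proved for the real symmetric form. *)
Lemma Im_dot u v : D u -> D v ->
  complex.Im (dot u v) = rdot ((Complex 0 (-1) : Cplx R) *: u) v.
Proof. by move=> Du Dv; rewrite dotZl// !partsE /=; ring. Qed.

Lemma Im_dot_self u : D u -> complex.Im (dot u u) = 0.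
Proof. by move=> Du; have [/(_ (ip_ge0 ip Du))[]] := ge0_complexP (dot u u). Qed.

Lemma rdot_ge0 u : D u -> 0 <= rdot u u.
Proof. by move=> Du; have [/(_ (ip_ge0 ip Du))[]] := ge0_complexP (dot u u). Qed.

Lemma dot_selfE u : D u -> dot u u = Complex (rdot u u) 0.
Proof. by move=> Du; apply: complex_eq => //=; rewrite Im_dot_self. Qed.

Lemma rdotD u v : D u -> D v ->
  rdot (u + v) (u + v) = rdot u u + rdot v v + 2 * rdot u v.
Proof.
move=> Du Dv; have Duv := ipD Du Dv.
rewrite dotDl// ReD (rdotC Du Duv) (rdotC Dv Duv) !dotDl// !ReD (rdotC Dv Du).
ring.
Qed.

Lemma rdotZ a u : D u -> rdot (a *: u) (a *: u) = sqmod a * rdot u u.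
Proof.
move=> Du; rewrite dotZl// ?dotZr//; last exact: ipZ.
by rewrite mulrA mulc_conj !partsE /=; ring.
Qed.

Lemma rdotN u : D u -> rdot (- u) (- u) = rdot u u.
Proof.
by move=> Du; rewrite -scaleN1r rdotZ// /sqmod !partsE /=; ring.
Qed.

Lemma rdot_zl (t : R) u v : D u -> D v ->
  rdot ((Complex t 0 : Cplx R) *: u) v = t * rdot u v.
Proof. by move=> Du Dv; rewrite dotZl// !partsE /=; ring. Qed.

Lemma dot_norm_ge0 u : 0 <= N u.
Proof. exact: sqrtr_ge0. Qed.

Lemma sqr_dot_norm u : D u -> N u ^+ 2 = rdot u u.
Proof. by move=> Du; rewrite /dot_norm sqr_sqrtr// rdot_ge0. Qed.

Lemma dot_normN u : D u -> N (- u) = N u.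
Proof. by move=> Du; rewrite /dot_norm rdotN. Qed.

Lemma dot_normBC u v : D u -> D v -> N (u - v) = N (v - u).
Proof. by move=> Du Dv; rewrite -dot_normN ?opprB//; exact: ipB. Qed.

Lemma dot_norm0 : N 0 = 0.
Proof. by rewrite /dot_norm dot0l ?sqrtr0//; exact: (ip0 ip). Qed.

(** The quadratic form [s, t |-> |s u + t v|^2] is nonnegative; evaluating it at
    a well chosen pair gives the inequality. *)
Lemma rdot_cauchy_schwarz u v : D u -> D v -> `|rdot u v| <= N u * N v.
Proof.
move=> Du Dv; rewrite -(ler_pXn2r (isT : (0 < 2)%N)) ?nnegrE//; last first.
  by rewrite mulr_ge0// dot_norm_ge0.
rewrite exprMn !sqr_dot_norm// real_normK ?num_real//.
have pos (s t : R) :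
    0 <= s ^+ 2 * rdot u u + t ^+ 2 * rdot v v + 2 * s * t * rdot u v.
  have Dsu := ipZ (Complex s 0) Du; have Dtv := ipZ (Complex t 0) Dv.
  have := rdot_ge0 (ipD Dsu Dtv); rewrite rdotD// !rdotZ// rdot_zl// (rdotC Du Dtv).
  by rewrite rdot_zl// (rdotC Dv Du) /sqmod /=; lra.
have qu := rdot_ge0 Du; have qv := rdot_ge0 Dv.
have [q0|q0] := eqVneq (rdot u u) 0.
  rewrite q0 mul0r.
  (* With |u| = 0 the form is linear in s; this pair makes it equal to
     - r^4 (|v|^2 + 2), where r is the real part of <u,v>. *)
  have := pos (- ((rdot v v + 1) * rdot u v)) (rdot u v ^+ 2); rewrite q0.
  have := sqr_ge0 (rdot u v); set s := rdot u v ^+ 2 => s0 h.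
  rewrite leNgt; apply/negP => s_gt0.
  have q2 : 0 < rdot v v + 2 by rewrite ltr_wpDl.
  have := mulr_gt0 (mulr_gt0 s_gt0 s_gt0) q2; apply/negP; rewrite -leNgt -oppr_ge0.
  by apply: le_trans h _; rewrite /s le_eqVlt; apply/orP; left; apply/eqP; ring.
have {}qu : 0 < rdot u u by rewrite lt_neqAle eq_sym q0.
(* The minimum over s for t = |u|^2. *)
by have := pos (- rdot u v) (rdot u u); nra.
Qed.

Lemma Im_dot_cauchy_schwarz u v :
  D u -> D v -> `|complex.Im (dot u v)| <= N u * N v.
Proof.
move=> Du Dv; rewrite Im_dot//.
have := rdot_cauchy_schwarz (ipZ (Complex 0 (-1)) Du) Dv.
by rewrite {1}/dot_norm rdotZ// /sqmod /= expr0n/= sqrrN expr1n add0r mul1r.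
Qed.

Lemma dot_normD u v : D u -> D v -> N (u + v) <= N u + N v.
Proof.
move=> Du Dv; have NN := addr_ge0 (dot_norm_ge0 u) (dot_norm_ge0 v).
rewrite -(ler_pXn2r (isT : (0 < 2)%N)) ?nnegrE ?dot_norm_ge0//.
rewrite (sqr_dot_norm (ipD Du Dv)) rdotD// sqrrD !sqr_dot_norm//.
have := rdot_cauchy_schwarz Du Dv; have := ler_norm (rdot u v).
by rewrite mulr2n; lra.
Qed.

Lemma dot_normB_trans u v w :
  D u -> D v -> D w -> N (u - w) <= N (u - v) + N (v - w).
Proof.
move=> Du Dv Dw; rewrite -[u - w](subrKA v).
by apply: dot_normD; apply: ipB.
Qed.

Lemma dot_normB_lip u v w : D u -> D v -> D w ->
  `|N (u - w) - N (u - v)| <= N (v - w).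
Proof.
move=> Du Dv Dw; have := dot_normB_trans Du Dv Dw.
have := dot_normB_trans Du Dw Dv; rewrite (dot_normBC Dw Dv) => h1 h2.
by rewrite ler_norml; apply/andP; split; lra.
Qed.

Lemma dot_norm_sum (r : seq nat) (F : nat -> V) :
  (forall i, D (F i)) -> N (\sum_(i <- r) F i) <= \sum_(i <- r) N (F i).
Proof.
move=> DF; elim: r => [|i r IH]; first by rewrite !big_nil dot_norm0.
rewrite !big_cons; apply: le_trans (dot_normD _ _) _ => //; first exact: ip_sum.
by rewrite lerD2l.
Qed.

(** Weaker than the Cauchy-Schwarz inequality, but the right-hand side is
    additive: under an integral sign it is integrable as soon as the squared
    norms are. *)
Lemma rdot_le_sqr u v : D u -> D v ->
  `|rdot u v| <= rdot u u + rdot v v.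
Proof.
move=> Du Dv; have DNv := ipN Dv.
have := rdot_ge0 (ipD Du Dv); have := rdot_ge0 (ipB Du Dv).
rewrite !rdotD// rdotN// (rdotC Du DNv) dotNl// ReN (rdotC Dv Du).
have := rdot_ge0 Du; have := rdot_ge0 Dv.
by move=> *; rewrite ler_norml; apply/andP; split; lra.
Qed.

Lemma Im_dot_le_sqr u v : D u -> D v ->
  `|complex.Im (dot u v)| <= rdot u u + rdot v v.
Proof.
move=> Du Dv; rewrite Im_dot//.
apply: le_trans (rdot_le_sqr (ipZ _ Du) Dv) _.
by rewrite rdotZ// /sqmod /= expr0n/= sqrrN expr1n add0r mul1r.
Qed.

End InnerProduct.

(** * Convergence and orthogonal expansions *)

Section Convergence.
Context {R : realType} {V : lmodType R[i]}.
Implicit Types (D : set V) (dot : V -> V -> Cplx R).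

Definition dot_cauchy dot (u_ : nat -> V) := forall e : R, 0 < e ->
  exists N : nat, forall m n : nat, (N <= m)%N -> (N <= n)%N ->
    dot_norm dot (u_ m - u_ n) < e.

Definition dot_cvg dot (u_ : nat -> V) (l : V) :=
  dot_norm dot (u_ n - l) @[n --> \oo] --> (0 : R).

Definition dot_complete D dot := forall u_ : nat -> V,
  (forall n, D (u_ n)) -> dot_cauchy dot u_ -> exists2 l, D l & dot_cvg dot u_ l.

Lemma dot_cvgP dot u_ l : dot_cvg dot u_ l <-> forall e : R, 0 < e ->
  exists N : nat, forall n, (N <= n)%N -> dot_norm dot (u_ n - l) < e.
Proof.
split=> [h e e0|h].
  move/cvgrPdist_lt/(_ _ e0): h => [N _ hN]; exists N => n Nn.
  by have := hN n Nn; rewrite /= sub0r normrN ger0_norm// sqrtr_ge0.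
apply/cvgrPdist_lt => e e0; have [N hN] := h e e0.
by exists N => // n /= Nn; rewrite sub0r normrN ger0_norm ?sqrtr_ge0// hN.
Qed.

Context {D : set V} {dot : V -> V -> Cplx R}.
Hypothesis ip : inner_product D dot.

Lemma dot_cvg_cauchy u_ l : (forall n, D (u_ n)) -> D l ->
  dot_cvg dot u_ l -> dot_cauchy dot u_.
Proof.
move=> Du Dl /dot_cvgP h e e0.
have [|N hN] := h (e / 2); first by rewrite divr_gt0.
exists N => m n Nm Nn; apply: le_lt_trans (dot_normB_trans ip _ Dl _) _ => //.
by rewrite (splitr e) (dot_normBC ip Dl)// ltrD// hN.
Qed.

Lemma cvg_dotl u_ l w : (forall n, D (u_ n)) -> D l -> D w ->
  dot_cvg dot u_ l -> (fun n => dot (u_ n) w) @ \oo --> dot l w.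
Proof.
move=> Du Dl Dw ul.
have N0 : (fun n => dot_norm dot (u_ n - l) * dot_norm dot w) @ \oo --> (0 : R).
  by rewrite -[X in _ --> X](mul0r (dot_norm dot w)); apply: cvgMl.
have DB n : D (u_ n - l) by apply: (ipB ip).
apply: cvg_complex; apply/cvgrPdist_le => e e0;
  move/cvgrPdist_le/(_ _ e0): N0; apply: filterS => n;
  rewrite sub0r normrN ger0_norm ?mulr_ge0 ?sqrtr_ge0//; apply: le_trans.
  rewrite distrC -ReN -ReD -(dotBl ip)//.
  exact: (rdot_cauchy_schwarz ip).
rewrite distrC -ImN -ImD -(dotBl ip)//.
exact: (Im_dot_cauchy_schwarz ip).
Qed.

Lemma cvg_dist_sqr u u_ l : D u -> (forall n, D (u_ n)) -> D l ->
  dot_cvg dot u_ l ->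
  (fun n => complex.Re (dot (u - u_ n) (u - u_ n))) @ \oo -->
    complex.Re (dot (u - l) (u - l)).
Proof.
move=> Du Du_ Dl ul.
have Dun n : D (u - u_ n) by exact: (ipB ip).
have Dul : D (u - l) by exact: (ipB ip).
under eq_fun do rewrite -(sqr_dot_norm ip)//.
rewrite -(sqr_dot_norm ip)//; apply: cvgM; apply/cvgrPdist_lt => e e0;
  move/dot_cvgP/(_ _ e0): ul => [N hN]; exists N => // n /= Nn;
  apply: le_lt_trans (hN n Nn); exact: (dot_normB_lip ip).
Qed.

End Convergence.

Section OrthogonalExpansion.
Context {R : realType} {V : lmodType R[i]} {D : set V} {dot : V -> V -> Cplx R}.
Hypothesis ip : inner_product D dot.
Context {v : nat -> V}.
Hypothesis Dv : forall n, D (v n).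
Hypothesis v_orth : forall m n, m <> n -> dot (v m) (v n) = 0.
Implicit Types (c : nat -> Cplx R).

Local Notation rdot u v := (complex.Re (dot u v)).

Definition fourier (u : V) (n : nat) : Cplx R := dot u (v n) / dot (v n) (v n).

Lemma orth_sum_in c m n : D (\sum_(m <= i < n) c i *: v i).
Proof. by apply: (ip_sum ip) => i; apply: (ipZ ip). Qed.

Lemma dot_orth_sum c n m : (m < n)%N ->
  dot (\sum_(0 <= i < n) c i *: v i) (v m) = c m * dot (v m) (v m).
Proof.
move=> mn; rewrite (dot_suml ip)//; last by move=> i; apply: (ipZ ip).
rewrite (bigD1_seq m)/= ?iota_uniq ?mem_index_iota//= (dotZl ip)//.
rewrite big1 ?addr0// => i /eqP im.
by rewrite (dotZl ip)// v_orth// mulr0.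
Qed.

Lemma rdot_orth_sum c m n :
  rdot (\sum_(m <= i < n) c i *: v i) (\sum_(m <= i < n) c i *: v i) =
  \sum_(m <= i < n) sqmod (c i) * rdot (v i) (v i).
Proof.
have [nm|mn] := leqP n m.
  by rewrite !big_geq// (dot0l ip)//; exact: (ip0 ip).
rewrite -(subnKC (ltnW mn)); elim: (n - m)%N => [|k IH].
  by rewrite addn0 !big_geq// (dot0l ip)//; exact: (ip0 ip).
set P := \sum_(m <= i < m + k) c i *: v i in IH *.
have cross : dot P (c (m + k)%N *: v (m + k)%N) = 0.
  have Dc i : D (c i *: v i) by apply: (ipZ ip).
  rewrite (dot_suml ip)// big_nat_cond big1// => i /andP[/andP[_ ik] _].
  rewrite (dotZl ip)// (dotZr ip)// v_orth ?mulr0// => ik'.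
  by move: ik; rewrite ik' ltnn.
rewrite addnS !big_nat_recr ?leq_addr//= -/P (rdotD ip); first last.
- exact: (ipZ ip).
- exact: orth_sum_in.
by rewrite IH (rdotZ ip)// cross /= mulr0 addr0.
Qed.

(** By Pythagoras, the squared distance of two partial sums is an increment of
    a nondecreasing bounded sequence of real numbers. *)
Lemma orth_series_cauchy c (B : R) :
  (forall n, \sum_(0 <= i < n) sqmod (c i) * rdot (v i) (v i) <= B) ->
  dot_cauchy dot (fun n => \sum_(0 <= i < n) c i *: v i).
Proof.
move=> leB; pose s n := \sum_(0 <= i < n) sqmod (c i) * rdot (v i) (v i).
have s_nd : nondecreasing_seq s.
  apply/nondecreasing_seqP => n; rewrite /s big_nat_recr//= lerDl.
  by rewrite mulr_ge0 ?sqmod_ge0// (rdot_ge0 ip).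
have /cvgrPdist_lt s_cvg : s @ \oo --> limn s.
  apply: nondecreasing_is_cvgn => //; exists B => _ [n _ <-]; exact: leB.
have DS m n : D (\sum_(m <= i < n) c i *: v i) by exact: orth_sum_in.
move=> e e0; have e2 : 0 < e ^+ 2 / 2 by rewrite divr_gt0// exprn_gt0.
have [N _ hN] := s_cvg _ e2.
have main m n : (N <= m)%N -> (m <= n)%N -> dot_norm dot
    (\sum_(0 <= i < m) c i *: v i - \sum_(0 <= i < n) c i *: v i) < e.
  move=> Nm mn; rewrite (dot_normBC ip)//.
  rewrite (big_cat_nat (leq0n m) mn)/= addrAC subrr add0r.
  rewrite -(ltr_pXn2r (isT : (0 < 2)%N)) ?nnegrE ?sqrtr_ge0 ?(ltW e0)//.
  rewrite (sqr_dot_norm ip)// rdot_orth_sum.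
  have -> : \sum_(m <= i < n) sqmod (c i) * rdot (v i) (v i) = s n - s m.
    by rewrite /s (big_cat_nat (leq0n m) mn)/= addrAC subrr add0r.
  have := hN m Nm; have := hN n (leq_trans Nm mn); rewrite /=.
  by rewrite !ltr_norml => /andP[h1 h2] /andP[h3 h4]; lra.
exists N => m n Nm Nn; case: (leqP m n) => [mn|/ltnW nm]; first exact: main.
by rewrite (dot_normBC ip)//; apply: main.
Qed.

Hypothesis v_neq0 : forall n, dot (v n) (v n) != 0.

(** The partial sum [P] is the orthogonal projection of [u]: [<u, P> = |P|^2], so
    that [|u - P|^2 = |u|^2 - |P|^2]. *)
Lemma bessel u n : D u ->
  \sum_(0 <= i < n) sqmod (fourier u i) * rdot (v i) (v i) <= rdot u u.
Proof.
move=> Du; rewrite -rdot_orth_sum.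
set P := \sum_(0 <= i < n) _; have DP : D P by exact: orth_sum_in.
have uP : rdot u P = rdot P P.
  rewrite (rdotC ip)// /P rdot_orth_sum (dot_suml ip)//; last first.
    by move=> i; apply: (ipZ ip).
  have -> : complex.Re (\sum_(0 <= i < n) dot (fourier u i *: v i) u) =
     \sum_(0 <= i < n) complex.Re (dot (fourier u i *: v i) u).
    by elim/big_rec2: _ => // i x y _ <-; rewrite ReD.
  apply: eq_bigr => i _; rewrite (dotZl ip)// (ip_conj ip Du (Dv i)).
  rewrite -[dot u _](divfK (v_neq0 i)) -/(fourier u i) rmorphM mulrA mulc_conj.
  by rewrite !partsE /=; ring.
have := rdot_ge0 ip (ipB ip Du DP).
have DNP := ipN ip DP.
rewrite (rdotD ip)// (rdotN ip)// (rdotC ip Du DNP) (dotNl ip)// ReN (rdotC ip DP Du) uP.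
lra.
Qed.

(** The difference of a vector and the sum of its Fourier series is orthogonal
    to every [v n], hence negligible when the system is total. *)
Lemma fourier_series_cvg u : dot_complete D dot ->
  (forall w, D w -> (forall n, dot w (v n) = 0) -> dot_norm dot w = 0) -> D u ->
  dot_cvg dot (fun n => \sum_(0 <= i < n) fourier u i *: v i) u.
Proof.
move=> D_complete v_total Du; set P := fun n => _.
have DP n : D (P n) by exact: orth_sum_in.
have [l Dl Pl] := D_complete P DP (orth_series_cauchy (fun n => bessel n Du)).
have lu : dot_norm dot (l - u) = 0.
  apply: v_total => [|m]; first exact: (ipB ip).
  rewrite (dotBl ip)//; apply/eqP; rewrite subr_eq0; apply/eqP.
  have h1 := cvg_dotl ip DP Dl (Dv m) Pl.
  have h2 : (fun n => dot (P n) (v m)) @ \oo --> dot u (v m).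
    apply: cvg_near_cst; exists m.+1 => // n /= mn.
    by rewrite /P dot_orth_sum// divfK.
  exact: (cvg_unique _ h1 h2).
move/dot_cvgP: Pl => Pl; apply/dot_cvgP => e e0.
have [N hN] := Pl e e0; exists N => n Nn.
apply: le_lt_trans (dot_normB_trans ip (DP n) Dl Du) _.
by rewrite lu addr0 hN.
Qed.

End OrthogonalExpansion.

(** * Families with the same Gram matrix *)

Section Transfer.
Context {R : realType} {X : Type} {V1 V2 : lmodType R[i]}
  {D1 : set V1} {dot1 : V1 -> V1 -> Cplx R}
  {D2 : set V2} {dot2 : V2 -> V2 -> Cplx R}.
Hypothesis ip1 : inner_product D1 dot1.
Hypothesis ip2 : inner_product D2 dot2.
Context {k1 : X -> V1} {k2 : X -> V2}.
Hypothesis Dk1 : forall x, D1 (k1 x).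
Hypothesis Dk2 : forall x, D2 (k2 x).
Hypothesis gram : forall x y, dot1 (k1 x) (k1 y) = dot2 (k2 x) (k2 y).

Lemma gram_suml (y : nat -> X) (c : nat -> Cplx R) m n x :
  dot1 (\sum_(m <= i < n) c i *: k1 (y i)) (k1 x) =
  dot2 (\sum_(m <= i < n) c i *: k2 (y i)) (k2 x).
Proof.
rewrite (dot_suml ip1)//; last by move=> i; apply: (ipZ ip1).
rewrite (dot_suml ip2)//; last by move=> i; apply: (ipZ ip2).
by apply: eq_bigr => i _; rewrite (dotZl ip1)// (dotZl ip2)// gram.
Qed.

Lemma gram_sum (y : nat -> X) (c : nat -> Cplx R) m n :
  dot_norm dot1 (\sum_(m <= i < n) c i *: k1 (y i)) =
  dot_norm dot2 (\sum_(m <= i < n) c i *: k2 (y i)).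
Proof.
have Ds1 : D1 (\sum_(m <= i < n) c i *: k1 (y i)).
  by apply: (ip_sum ip1) => i; apply: (ipZ ip1).
have Ds2 : D2 (\sum_(m <= i < n) c i *: k2 (y i)).
  by apply: (ip_sum ip2) => i; apply: (ipZ ip2).
congr (Num.sqrt (complex.Re _)).
rewrite [LHS](dot_suml ip1)//; last by move=> i; apply: (ipZ ip1).
rewrite [RHS](dot_suml ip2)//; last by move=> i; apply: (ipZ ip2).
apply: eq_bigr => i _; rewrite (dotZl ip1)// (dotZl ip2)//; congr (_ * _).
by rewrite (ip_conj ip1 Ds1)// (ip_conj ip2 Ds2)// gram_suml.
Qed.

(** Partial sums with the same coefficients have the same mutual distances in
    both spaces, so that a convergent series in the first space converges in
    the second one, and the two limits have the same products with the
    families. *)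
Lemma gram_transfer (y : nat -> X) (c : nat -> Cplx R) f :
  dot_complete D2 dot2 -> D1 f ->
  dot_cvg dot1 (fun n => \sum_(0 <= i < n) c i *: k1 (y i)) f ->
  exists h, [/\ D2 h,
    dot_cvg dot2 (fun n => \sum_(0 <= i < n) c i *: k2 (y i)) h &
    forall x, dot2 h (k2 x) = dot1 f (k1 x)].
Proof.
move=> D2_complete Df.
set P1 := fun n => _ => P1f; pose P2 n := \sum_(0 <= i < n) c i *: k2 (y i).
have DP1 n : D1 (P1 n) by apply: (ip_sum ip1) => i; apply: (ipZ ip1).
have DP2 n : D2 (P2 n) by apply: (ip_sum ip2) => i; apply: (ipZ ip2).
have P12 m n : dot_norm dot1 (P1 m - P1 n) = dot_norm dot2 (P2 m - P2 n).
  have le_case i j : (i <= j)%N ->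
      dot_norm dot1 (P1 j - P1 i) = dot_norm dot2 (P2 j - P2 i).
    move=> ij; rewrite /P1 /P2 !(big_cat_nat (leq0n i) ij)/=.
    by rewrite ![_ + _ - _]addrAC !subrr !add0r gram_sum.
  case: (leqP m n) => [mn|/ltnW nm]; last exact: le_case.
  by rewrite (dot_normBC ip1)// (dot_normBC ip2)// le_case.
have [h Dh P2h] : exists2 h, D2 h & dot_cvg dot2 P2 h.
  apply: D2_complete => // e e0.
  have [N hN] := dot_cvg_cauchy ip1 DP1 Df P1f e0.
  by exists N => m n Nm Nn; rewrite -P12 hN.
exists h; split=> // x.
have h1 := cvg_dotl ip1 DP1 Df (Dk1 x) P1f.
have := cvg_dotl ip2 DP2 Dh (Dk2 x) P2h.
under eq_fun do rewrite -gram_suml.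
by move=> h2; apply: (cvg_unique _ h2 h1).
Qed.

End Transfer.

(** * The coordinate space *)

Section CoordinateSpaceTheory.
Context {R : realType} {d : option nat}.
Implicit Types (u v w : nat -> Cplx R) (a : Cplx R).

Local Notation C := (@Cd R d).
Local Notation dot := (@Cd_dot R).

Lemma summable_sqmodP u :
  (\sum_(0 <= k <oo) (complex.Re (`|u k| ^+ 2))%:E < +oo)%E <->
  cvgn (series (fun k => sqmod (u k))).
Proof.
have t0 k : (0 <= (complex.Re (`|u k| ^+ 2))%:E)%E.
  by rewrite lee_fin Re_sqr_norm sqmod_ge0.
have sE n : (\sum_(0 <= k < n) (complex.Re (`|u k| ^+ 2))%:E)%E =
    (series (fun k => sqmod (u k)) n)%:E.
  by rewrite sumEFin seriesEnat; under eq_bigr do rewrite Re_sqr_norm.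
have nd : nondecreasing_seq (series (fun k => sqmod (u k))).
  by apply/nondecreasing_seqP => n; rewrite seriesSr lerDl sqmod_ge0.
split=> [fin|cv].
  have S0 : (0 <= \sum_(0 <= k <oo) (complex.Re (`|u k| ^+ 2))%:E)%E.
    by apply: nneseries_ge0 => k _ _; exact: t0.
  apply: nondecreasing_is_cvgn => //.
  exists (fine (\sum_(0 <= k <oo) (complex.Re (`|u k| ^+ 2))%:E)%E).
  move=> _ [n _ <-]; rewrite -lee_fin fineK; last first.
    by rewrite ge0_fin_numE.
  by rewrite -sE; apply: nneseries_lim_ge => k _ _; exact: t0.
apply: (@le_lt_trans _ _ (limn (series (fun k => sqmod (u k))))%:E).
  2: by rewrite ltry.
apply: lime_le; first by apply: is_cvg_nneseries => k _ _; exact: t0.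
apply: nearW => n; rewrite sE lee_fin; exact: nondecreasing_cvgn_le.
Qed.

Lemma CdP u : C u <-> (forall k, ~~ Defs.coord d k -> u k = 0) /\
  cvgn (series (fun k => sqmod (u k))).
Proof. by split=> -[u0 /summable_sqmodP]. Qed.

Lemma Cd0 : C 0.
Proof.
apply/CdP; split=> //; apply/cvg_ex; exists 0; apply: cvg_near_cst.
by apply: nearW => n; rewrite seriesEnat/= big1// => k _;
  rewrite /sqmod/= expr0n/= addr0.
Qed.

Lemma Cd_lin a u v : C u -> C v -> C (a *: u + v).
Proof.
move=> /CdP[u0 cu] /CdP[v0 cv]; apply/CdP; split.
  by move=> k dk; rewrite -[LHS]/(a * u k + v k) u0// v0// mulr0 addr0.
apply: (@series_le_cvg _ _ (fun k => (2 * sqmod a) * sqmod (u k) + 2 * sqmod (v k))).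
- by move=> k; exact: sqmod_ge0.
- by move=> k; rewrite addr_ge0 ?mulr_ge0 ?sqmod_ge0.
- by move=> k; rewrite -[X in sqmod X]/(a * u k + v k) -mulrA -sqmodM sqmodD_le.
rewrite (_ : series _ = (fun n => 2 * sqmod a * series (fun k => sqmod (u k)) n +
   2 * series (fun k => sqmod (v k)) n)).
  by apply: is_cvgD; apply: is_cvgMr.
by apply/funext => n; rewrite !seriesEnat /= big_split/= !mulr_sumr.
Qed.

(** The inner product of the coordinate space is a limit that has a meaning only
    when it exists; the real and imaginary parts of the terms are dominated by
    the summable [|u_k|^2 + |v_k|^2]. *)
Lemma Cd_dot_cvg u v : C u -> C v ->
  series (fun k => u k * (v k)^* : Cplx R) @ \oo --> dot u v.
Proof.
move=> /CdP[_ cu] /CdP[_ cv].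
have dom : cvgn (series (fun k => sqmod (u k) + sqmod (v k))).
  rewrite (_ : series _ = (fun n => series (fun k => sqmod (u k)) n +
    series (fun k => sqmod (v k)) n)); first exact: is_cvgD.
  by apply/funext => n; rewrite !seriesEnat /= big_split.
have part (F : Cplx R -> R) :
    (forall a b, `|F (a * b^*)| <= sqmod a + sqmod b) ->
    cvgn (series (fun k => F (u k * (v k)^*))).
  move=> leF; apply: normed_cvg; apply: series_le_cvg dom => k.
  - exact: normr_ge0.
  - exact: addr_ge0 (sqmod_ge0 _) (sqmod_ge0 _).
  - exact: leF.
have cR := part _ (fun a b => proj1 (normr_parts_conj_le a b)).
have cI := part _ (fun a b => proj2 (normr_parts_conj_le a b)).
have h : series (fun k => u k * (v k)^* : Cplx R) @ \oo -->
    (Complex (limn (series (fun k => complex.Re (u k * (v k)^*))))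
            (limn (series (fun k => complex.Im (u k * (v k)^*)))) : Cplx R).
  apply: cvg_complex => /=.
    by under eq_fun do rewrite seriesEnat/= Re_sum; exact: cR.
  by under eq_fun do rewrite seriesEnat/= Im_sum; exact: cI.
suff -> : dot u v = Complex (limn (series (fun k => complex.Re (u k * (v k)^*))))
    (limn (series (fun k => complex.Im (u k * (v k)^*)))) by [].
by apply: cvg_lim h; exact: norm_hausdorff.
Qed.

Lemma sqmod_series_cvg u : C u ->
  series (fun k => sqmod (u k)) @ \oo --> complex.Re (dot u u).
Proof.
move=> Cu; have [+ _] := cvg_parts (Cd_dot_cvg Cu Cu).
under eq_fun do rewrite seriesEnat/= Re_sum.
by under eq_fun do under eq_bigr do rewrite mulc_conj /=.
Qed.

Lemma Cd_inner_product : inner_product C dot.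
Proof.
split; first exact: Cd0.
- exact: Cd_lin.
- move=> a u v w Cu Cv Cw; have Cuv := Cd_lin a Cu Cv.
  have h1 := Cd_dot_cvg Cuv Cw.
  have h2 : series (fun k => (a *: u + v) k * (w k)^* : Cplx R) @ \oo -->
      (a * dot u w + dot v w : Cplx R).
    rewrite (_ : series _ = (fun n => a * series (fun k => u k * (w k)^*) n +
      series (fun k => v k * (w k)^*) n : Cplx R)).
      by apply: cvgD; [apply: cvgMr|]; exact: Cd_dot_cvg.
    apply/funext => n; rewrite !seriesEnat /= mulr_sumr -big_split/=.
    by apply: eq_bigr => k _; rewrite mulrA -mulrDl.
  exact: (cvg_unique _ h1 h2).
- move=> u v Cu Cv; have h1 := Cd_dot_cvg Cv Cu.
  have h2 : series (fun k => v k * (u k)^* : Cplx R) @ \oo --> ((dot u v)^* : Cplx R).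
    have [hr hi] := cvg_parts (Cd_dot_cvg Cu Cv).
    apply: cvg_complex.
      rewrite ReJ; move: hr; under eq_fun do rewrite seriesEnat/= Re_sum.
      under [X in _ -> X @ _ --> _]eq_fun do rewrite seriesEnat/= Re_sum.
      under eq_fun do under eq_bigr do rewrite !partsE mulrN opprK.
      by under [X in _ -> X @ _ --> _]eq_fun do under eq_bigr do
        rewrite !partsE mulrN opprK mulrC [X in _ + X]mulrC.
    rewrite ImJ; move/cvgN: hi; apply: cvg_trans.
    rewrite (_ : (fun n => _) = (fun n => - complex.Im
       (series (fun k => u k * (v k)^*) n)))//.
    apply/funext => n; rewrite !seriesEnat/= !Im_sum -sumrN.
    by apply: eq_bigr => k _; rewrite !partsE; ring.
  exact: (cvg_unique _ h1 h2).
move=> u Cu; apply/ge0_complexP; have [hr hi] := cvg_parts (Cd_dot_cvg Cu Cu).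
split.
  rewrite -(cvg_lim _ hr)//; apply: limr_ge.
    by apply/cvg_ex; exists (complex.Re (dot u u)).
  apply: nearW => n; rewrite seriesEnat/= Re_sum; apply: sumr_ge0 => k _.
  by rewrite mulc_conj/= sqmod_ge0.
rewrite -(cvg_lim _ hi)//; apply/cvg_lim => //; apply: cvg_near_cst.
by apply: nearW => n; rewrite seriesEnat/= Im_sum big1// => k _; rewrite mulc_conj.
Qed.

Lemma sqmod_series_le u n : C u ->
  \sum_(0 <= k < n) sqmod (u k) <= complex.Re (dot u u).
Proof.
move=> Cu; have cv := sqmod_series_cvg Cu.
rewrite -(cvg_lim _ cv)//.
have -> : \sum_(0 <= k < n) sqmod (u k) = series (fun k => sqmod (u k)) n.
  by rewrite seriesEnat.
apply: nondecreasing_cvgn_le; last by apply/cvg_ex; exists (complex.Re (dot u u)).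
by apply/nondecreasing_seqP => m; rewrite seriesSr lerDl sqmod_ge0.
Qed.

Lemma Cd_coord_le u k : C u ->
  `|complex.Re (u k)| <= Cd_norm u /\ `|complex.Im (u k)| <= Cd_norm u.
Proof.
move=> Cu; have := sqmod_series_le k.+1 Cu; rewrite big_nat_recr//= => le1.
have le2 : sqmod (u k) <= complex.Re (dot u u).
  by apply: le_trans le1; rewrite lerDr sumr_ge0// => i _; exact: sqmod_ge0.
by split; rewrite -sqrtr_sqr; apply: ler_wsqrtr; apply: le_trans le2;
  rewrite ?lerDl ?lerDr sqr_ge0.
Qed.

End CoordinateSpaceTheory.

(** * Measurable maps into the coordinate space *)

Section CoordinateMeasurability.
Context {R : realType} {d : option nat}.
Context {disp : measure_display} {Omega : measurableType disp}.
Implicit Types (u v : nat -> Cplx R) (f g : Omega -> nat -> Cplx R).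

Local Notation C := (@Cd R d).

Definition coord_measurable f := forall k,
  measurable_fun setT (fun w => complex.Re (f w k)) /\
  measurable_fun setT (fun w => complex.Im (f w k)).

Lemma halfspace_open (F : Cplx R -> R) k r :
  (forall u v, C u -> C v -> F (u k) - F (v k) <= Cd_norm (v - u)) ->
  Cd_open d [set u | C u /\ r < F (u k)].
Proof.
move=> FB; split=> [u []//|u [Cu ru]].
exists (F (u k) - r); first by rewrite subr_gt0.
move=> v Cv vu; split=> //; have := le_lt_trans (FB u v Cu Cv) vu.
by rewrite ltrD2l ltrN2.
Qed.

(** A coordinate is a 1-Lipschitz function, so the sets where its real or
    imaginary part exceeds a given number are open. *)
Lemma Cd_measurable_coord f : Cd_measurable d f -> coord_measurable f.
Proof.
move=> [Cf mf] k.
have part (F : Cplx R -> R) :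
    (forall u v, C u -> C v -> F (u k) - F (v k) <= Cd_norm (v - u)) ->
    measurable_fun setT (fun w => F (f w k)).
  move=> FB; apply: (measurability _ (RGenOInfty.measurableE R)).
  move=> _ [_ [r ->] <-]; rewrite setTI.
  have -> : (fun w => F (f w k)) @^-1` `]r, +oo[%classic =
      setT `&` f @^-1` [set u | C u /\ r < F (u k)].
    apply/seteqP; split=> w /=; rewrite in_itv/= andbT; first by move=> ?; split.
    by case=> _ [].
  apply: mf => //; apply: sub_sigma_algebra; exact: halfspace_open.
have CB u v : C u -> C v -> C (v - u).
  by move=> Cu Cv; exact: (ipB Cd_inner_product).
split; apply: part => u v Cu Cv;
  have [hr hi] := Cd_coord_le k (CB u v Cu Cv).
  apply: le_trans hr; rewrite -[(v - u) k]/(v k - u k) ReD ReN distrC.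
  exact: ler_norm.
apply: le_trans hi; rewrite -[(v - u) k]/(v k - u k) ImD ImN distrC.
exact: ler_norm.
Qed.

Lemma coord_measurable_lin (a : Cplx R) f g :
  coord_measurable f -> coord_measurable g ->
  coord_measurable (fun w => a *: f w + g w).
Proof.
move=> mf mg k; have [fr fi] := mf k; have [gr gi] := mg k.
have E w : (a *: f w + g w) k = a * f w k + g w k by [].
split.
  under eq_fun do rewrite E !partsE.
  by apply: measurable_funD => //; apply: measurable_funB; apply: measurable_funM.
under eq_fun do rewrite E !partsE.
by apply: measurable_funD => //; apply: measurable_funD; apply: measurable_funM.
Qed.

Lemma measurable_Cd_dot f g : (forall w, C (f w)) -> (forall w, C (g w)) ->
  coord_measurable f -> coord_measurable g ->
  measurable_fun setT (fun w => complex.Re (Cd_dot (f w) (g w))) /\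
  measurable_fun setT (fun w => complex.Im (Cd_dot (f w) (g w))).
Proof.
move=> Cf Cg mf mg.
have h w := cvg_parts (Cd_dot_cvg (Cf w) (Cg w)).
split; [apply: measurable_fun_cvg (fun w _ => proj1 (h w))
       |apply: measurable_fun_cvg (fun w _ => proj2 (h w))] => n.
  under eq_fun do rewrite seriesEnat/= Re_sum.
  apply: measurable_sum => k; under eq_fun do rewrite !partsE.
  have [fr fi] := mf k; have [gr gi] := mg k.
  by apply: measurable_funB; apply: measurable_funM => //; apply: measurableT_comp.
under eq_fun do rewrite seriesEnat/= Im_sum.
apply: measurable_sum => k; under eq_fun do rewrite !partsE.
have [fr fi] := mf k; have [gr gi] := mg k.
by apply: measurable_funD; apply: measurable_funM => //; apply: measurableT_comp.
Qed.

Lemma finite_support_Cd u N : (forall k, ~~ Defs.coord d k -> u k = 0) ->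
  (forall k, (N <= k)%N -> u k = 0) -> C u.
Proof.
move=> u0 uN; apply/CdP; split=> //.
apply/cvg_ex; exists (series (fun k => sqmod (u k)) N); apply: cvg_near_cst.
exists N => // n /= Nn; rewrite !seriesEnat /= (big_cat_nat (leq0n N) Nn)/=.
rewrite [X in _ + X]big1_seq ?addr0// => k.
rewrite mem_index_iota => /andP[_ /andP[Nk _]].
by rewrite uN// /sqmod/= expr0n/= addr0.
Qed.

(** A countable dense family. The coordinates outside the range prescribed by [d]
    are set to zero, as membership in the coordinate space requires. *)
Definition rat_point (s : seq (rat * rat)) : nat -> Cplx R := fun k =>
  if Defs.coord d k then
    Complex (ratr (nth (0, 0) s k).1) (ratr (nth (0, 0) s k).2)
  else 0.

Lemma rat_point_big s k : (size s <= k)%N -> rat_point s k = 0.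
Proof.
by move=> sk; rewrite /rat_point nth_default//= !rmorph0; case: Defs.coord.
Qed.

Lemma Cd_rat_point s : C (rat_point s).
Proof.
apply: (@finite_support_Cd _ (size s)) => k; last exact: rat_point_big.
by rewrite /rat_point; case: Defs.coord.
Qed.

(** The tail of the series of squares beyond some [N] is small; the first [N]
    coordinates are then approximated by Gaussian rationals. *)
Lemma rat_point_dense u e : C u -> 0 < e ->
  exists s, Cd_norm (u - rat_point s) < e.
Proof.
move=> Cu e0; pose L := complex.Re (Cd_dot u u).
have e8 : 0 < e ^+ 2 / 8 by rewrite divr_gt0// exprn_gt0.
have /cvgrPdist_lt/(_ _ e8)[N _ hN] := sqmod_series_cvg Cu.
have tail n : (N <= n)%N -> \sum_(N <= k < n) sqmod (u k) <= e ^+ 2 / 8.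
  move=> Nn; have := sqmod_series_le n Cu; have := hN N (leqnn N).
  rewrite /= seriesEnat/= (big_cat_nat (leq0n N) Nn)/= ltr_norml.
  by move=> /andP[_ h1] h2; lra.
(* The error on N coordinates is at most 2 N del^2 <= e^2 / 8. *)
pose t : R := N.+1%:R^-1; pose del := e / 4 * t.
have t0 : 0 < t by rewrite invr_gt0.
have del0 : 0 < del by rewrite mulr_gt0// divr_gt0.
have near_rat (x : R) : exists q : rat, `|x - ratr q| < del.
  have [|q] := @rat_in_itvoo R (x - del) (x + del).
    by rewrite ltrD2l gtrN.
  rewrite in_itv/= => /andP[h1 h2]; exists q.
  by rewrite ltr_norml; apply/andP; split; lra.
have /choice[r hr] := fun k => near_rat (complex.Re (u k)).
have /choice[i hi] := fun k => near_rat (complex.Im (u k)).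
exists (mkseq (fun k => (r k, i k)) N); set s := mkseq _ N.
have Cq := Cd_rat_point s; have Cw := ipB Cd_inner_product Cu Cq.
set w := u - rat_point s in Cw *.
have wE k : w k = u k - rat_point s k by [].
have small k : (k < N)%N -> sqmod (w k) <= 2 * del ^+ 2.
  move=> kN; rewrite wE /rat_point; case: ifPn => [ck|nk]; last first.
    have [u0 _] := Cu; rewrite u0// subr0 /sqmod/= expr0n/= addr0.
    by rewrite mulr_ge0// sqr_ge0.
  rewrite nth_mkseq//= /sqmod !partsE /=.
  have sq (x : R) : `|x| < del -> x ^+ 2 <= del ^+ 2.
    by move=> xd; rewrite -real_normK ?num_real//; apply: lerXn2r; rewrite ?nnegrE// ltW.
  by have := sq _ (hr k); have := sq _ (hi k); lra.
have big n : (N <= n)%N -> \sum_(0 <= k < n) sqmod (w k) <= e ^+ 2 / 4.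
  move=> Nn; rewrite (big_cat_nat (leq0n N) Nn)/=.
  have h1 : \sum_(0 <= k < N) sqmod (w k) <= N%:R * (2 * del ^+ 2).
    apply: (@le_trans _ _ (\sum_(0 <= k < N) 2 * del ^+ 2)); last first.
      by rewrite sumr_const_nat subn0 [leRHS]mulr_natl.
    by rewrite !big_mkord; apply: ler_sum => k _; exact: small.
  have h2 : \sum_(N <= k < n) sqmod (w k) <= e ^+ 2 / 8.
    rewrite (eq_big_nat _ _ (F2 := fun k => sqmod (u k))) ?tail// => k /andP[Nk _].
    by rewrite wE rat_point_big ?subr0// size_mkseq.
  have Nt : N%:R * t <= 1.
    by rewrite ler_pdivrMr// mul1r ler_nat.
  have t1 : t <= 1 by rewrite invf_le1// ler1n.
  have h3 : N%:R * (2 * del ^+ 2) <= e ^+ 2 / 8.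
    have -> : N%:R * (2 * del ^+ 2) = e ^+ 2 / 8 * ((N%:R * t) * t).
      by rewrite /del; field.
    apply: ler_piMr; first exact: ltW.
    by apply: mulr_ile1 => //; [rewrite mulr_ge0// ltW|exact: ltW].
  lra.
have le4 : complex.Re (Cd_dot w w) <= e ^+ 2 / 4.
  rewrite -(cvg_lim _ (sqmod_series_cvg Cw))//; apply: limr_le.
    by apply/cvg_ex; exists (complex.Re (Cd_dot w w)); exact: (sqmod_series_cvg Cw).
  by exists N => // n /= Nn; rewrite seriesEnat/= big.
rewrite -(ltr_pXn2r (isT : (0 < 2)%N)) ?nnegrE ?sqrtr_ge0 ?(ltW e0)//.
rewrite (sqr_dot_norm Cd_inner_product Cw).
by apply: le_lt_trans le4 _; lra.
Qed.

(** The coordinate space being separable, each of its open sets is a countable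
    union of balls, and a ball is described by countably many conditions on the
    coordinates. *)
Lemma coord_measurable_Cd f : (forall w, C (f w)) -> coord_measurable f ->
  Cd_measurable d f.
Proof.
move=> Cf mf; split=> //.
apply: (@measurability _ _ Omega
  (g_sigma_algebraType (@Cd_open R d)) setT f (@Cd_open R d)) => //.
move=> _ [U [UC Uopen] <-]; rewrite setTI.
pose ball (p : seq (rat * rat) * nat) :=
  [set v | C v /\ Cd_norm (v - rat_point p.1) < p.2.+1%:R^-1].
pose F p := if `[< ball p `<=` U >] then f @^-1` (ball p) else set0.
have -> : f @^-1` U = \bigcup_p F p.
  apply/seteqP; split=> [w Uw|w [p _]]; last first.
    by rewrite /F; case: asboolP => // pU; exact: pU.
  have [e e0 eU] := Uopen _ Uw.
  have [n ne] := ltr_add_invr (divr_gt0 e0 (ltr0n _ 2)).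
  rewrite add0r in ne.
  have n0 : 0 < n.+1%:R^-1 :> R by rewrite invr_gt0.
  have [s us] := rat_point_dense (Cf w) n0.
  exists (s, n) => //; rewrite /F asboolT//= => v [Cv vs].
  apply: eU => //.
  apply: le_lt_trans (dot_normB_trans Cd_inner_product Cv (Cd_rat_point s) (Cf w)) _.
  rewrite (dot_normBC Cd_inner_product (Cd_rat_point s) (Cf w)).
  by rewrite (splitr e) ltrD// (lt_trans _ ne).
apply: countable_bigcupT_measurable => // p.
rewrite /F; case: asboolP => // _.
have mB : coord_measurable (fun w => (1 : Cplx R) *: f w + - rat_point p.1).
  by apply: coord_measurable_lin => // k; split; exact: measurable_cst.
have CB w : C ((1 : Cplx R) *: f w + - rat_point p.1).
  apply: (ip_lin Cd_inner_product) => //.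
  exact: (ipN Cd_inner_product (Cd_rat_point _)).
have [mdot _] := measurable_Cd_dot CB CB mB mB.
have -> : f @^-1` ball p = (fun w => complex.Re (Cd_dot
    ((1 : Cplx R) *: f w + - rat_point p.1) ((1 : Cplx R) *: f w + - rat_point p.1))
    < p.2.+1%:R^-1 ^+ 2) @^-1` [set true].
  apply/seteqP; split=> w /=; rewrite -(sqr_dot_norm Cd_inner_product (CB w)) scale1r.
    by move=> [_ lt1]; rewrite ltr_pXn2r// ?nnegrE ?sqrtr_ge0.
  by move=> lt2; split=> //; move: lt2; rewrite ltr_pXn2r// ?nnegrE ?sqrtr_ge0.
rewrite -[X in measurable X]setTI.
by apply: measurable_fun_ltr => //; exact: measurable_cst.
Qed.

Lemma Cd_measurableP f : Cd_measurable d f <->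
  (forall w, C (f w)) /\ coord_measurable f.
Proof.
split=> [mf|[Cf mf]]; last exact: coord_measurable_Cd.
by split; [case: mf|exact: Cd_measurable_coord].
Qed.

End CoordinateMeasurability.

(** * The direct integral as an inner product space *)

Lemma isometry0 (R : realType) (d : option nat) (V : lmodType R[i])
    (H : hilbert V) (E : V -> nat -> Cplx R) : linear_isometry_Cd d H E -> E 0 = 0.
Proof.
move=> [_ linE _]; have H0 := hcar0 H.
have := linE 1 0 0 H0 H0; rewrite !scale1r addr0.
by move/eqP; rewrite -[X in X == _]addr0 => /eqP/addrI.
Qed.

(** Polarization; the imaginary part of a product is the real part of the
    product of [- i u] with [v]. *)
Lemma isometry_dot (R : realType) (d : option nat) (V : lmodType R[i])
    (H : hilbert V) (E : V -> nat -> Cplx R) (u v : V) :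
  linear_isometry_Cd d H E -> hcar H u -> hcar H v ->
  Cd_dot (E u) (E v) = hdot H u v.
Proof.
move=> isoE Hu Hv; have [CE linE normE] := isoE.
have ipH := hilbert_inner_product H; have ipC := @Cd_inner_product R d.
have sqE x : hcar H x ->
    complex.Re (Cd_dot (E x) (E x)) = complex.Re (hdot H x x).
  move=> Hx; rewrite -(sqr_dot_norm ipC (CE _ Hx)) -(sqr_dot_norm ipH Hx).
  by congr (_ ^+ 2); exact: normE.
have reE x y : hcar H x -> hcar H y ->
    complex.Re (Cd_dot (E x) (E y)) = complex.Re (hdot H x y).
  move=> Hx Hy; have := sqE _ (ipD ipH Hx Hy).
  have -> : E (x + y) = E x + E y.
    by have := linE 1 x y Hx Hy; rewrite !scale1r.
  rewrite (rdotD ipC (CE _ Hx) (CE _ Hy)) (rdotD ipH Hx Hy) !sqE//.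
  by move/addrI/mulfI => ->.
have H0 := ip0 ipH.
apply: complex_eq; first exact: reE.
have Hiu := ipZ ipH (Complex 0 (-1)) Hu.
rewrite (Im_dot ipC (CE _ Hu) (CE _ Hv)) (Im_dot ipH Hu Hv) -reE//.
congr (complex.Re (Cd_dot _ _)).
by have := linE (Complex 0 (-1)) u 0 Hu H0; rewrite !addr0 (isometry0 isoE) addr0.
Qed.

Section ComplexIntegral.
Context {R : realType} {disp : measure_display} {Omega : measurableType disp}.
Variable mu : {measure set Omega -> \bar R}.
Implicit Types f g : Omega -> Cplx R.

Definition cintegrable f :=
  mu.-integrable setT (fun w => (complex.Re (f w))%:E) /\
  mu.-integrable setT (fun w => (complex.Im (f w))%:E).

Lemma cintegral_lin (a : Cplx R) f g : cintegrable f -> cintegrable g ->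
  cintegral mu (fun w => a * f w + g w : Cplx R) =
  a * cintegral mu f + cintegral mu g.
Proof.
move=> [fr fi] [gr gi].
have iZ (c : R) (h : Omega -> R) : mu.-integrable setT (fun w => (h w)%:E) ->
    mu.-integrable setT (fun w => (c * h w)%:E).
  by move=> ih; under eq_fun do rewrite EFinM; exact: integrableZl.
have iD (h k : Omega -> R) : mu.-integrable setT (fun w => (h w)%:E) ->
    mu.-integrable setT (fun w => (k w)%:E) ->
    mu.-integrable setT (fun w => (h w + k w)%:E).
  by move=> ih ik; under eq_fun do rewrite EFinD; exact: integrableD.
apply: complex_eq; rewrite !partsE /=.
  under eq_Rintegral do rewrite !partsE -mulNr.
  rewrite RintegralD//; last by apply: iD; apply: iZ.
  by rewrite RintegralD ?RintegralZl ?mulNr//; apply: iZ.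
under eq_Rintegral do rewrite !partsE.
rewrite RintegralD//; last by apply: iD; apply: iZ.
by rewrite RintegralD ?RintegralZl//; apply: iZ.
Qed.

End ComplexIntegral.

Section DirectIntegral.
Context {R : realType} {X : Type}.
Context {disp : measure_display} {Omega : measurableType disp}.
Context {mu : {measure set Omega -> \bar R}} {d : option nat}.
Context {H_ : Omega -> hilbert (X -> Cplx R)}.
Context {E : Omega -> (X -> Cplx R) -> nat -> Cplx R}.
Hypothesis E_isometry : forall w, linear_isometry_Cd d (H_ w) (E w).
Implicit Types (f g : Omega -> X -> Cplx R).

Local Notation D := (direct_integral mu d H_ E).
Local Notation mcs := (measurable_cross_section d H_ E).
Local Notation rdot_at w u v := (complex.Re (hdot (H_ w) u v)).
Local Notation ipH w := (hilbert_inner_product (H_ w)).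

Definition direct_dot f g : Cplx R :=
  cintegral mu (fun w => hdot (H_ w) (f w) (g w)).

Lemma mcsP f : mcs f <->
  cross_section H_ f /\ coord_measurable (fun w => E w (f w)).
Proof.
split=> [[cf /Cd_measurableP[_ mf]]|[cf mf]]; split=> //.
apply/Cd_measurableP; split=> // w; have [CE _ _] := E_isometry w.
exact: CE (cf w).
Qed.

Lemma mcs0 : mcs 0.
Proof.
apply/mcsP; split=> [w|k]; first exact: hcar0.
have E0 w : E w ((0 : Omega -> X -> Cplx R) w) k = 0.
  by rewrite (isometry0 (E_isometry w)).
by split; under eq_fun do rewrite E0; exact: measurable_cst.
Qed.

Lemma mcs_lin (a : Cplx R) f g : mcs f -> mcs g -> mcs (a *: f + g).
Proof.
move=> /mcsP[cf mf] /mcsP[cg mg]; apply/mcsP; split=> [w|].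
  exact: hcar_lin (cf w) (cg w).
have := coord_measurable_lin a mf mg; congr (coord_measurable _).
apply/funext => w; have [_ linE _] := E_isometry w.
by rewrite -linE.
Qed.

Lemma measurable_hdot f g : mcs f -> mcs g ->
  measurable_fun setT (fun w => rdot_at w (f w) (g w)) /\
  measurable_fun setT (fun w => complex.Im (hdot (H_ w) (f w) (g w))).
Proof.
move=> mf mg; have /mcsP[cf nf] := mf; have /mcsP[cg ng] := mg.
have CEf w : Cd d (E w (f w)) by have [CE _ _] := E_isometry w; exact: CE.
have CEg w : Cd d (E w (g w)) by have [CE _ _] := E_isometry w; exact: CE.
have [mr mi] := measurable_Cd_dot CEf CEg nf ng.
have dotE w := isometry_dot (E_isometry w) (cf w) (cg w).
by split; under eq_fun do rewrite -dotE.
Qed.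

Lemma direct_integralP f : D f <-> mcs f /\
  mu.-integrable setT (fun w => (rdot_at w (f w) (f w))%:E).
Proof.
have sqE : mcs f -> (\int[mu]_w (dot_norm (hdot (H_ w)) (f w) ^+ 2)%:E =
    \int[mu]_w `|(rdot_at w (f w) (f w))%:E|)%E.
  move=> [cf _]; apply: eq_integral => w _.
  rewrite (sqr_dot_norm (ipH w) (cf w)) gee0_abs// lee_fin.
  exact: (rdot_ge0 (ipH w) (cf w)).
split=> [[mf fin]|[mf /integrableP[_ fin]]]; split=> //.
  apply/integrableP; split; last by rewrite -sqE.
  by apply/measurable_EFinP; have [] := measurable_hdot mf mf.
by rewrite sqE.
Qed.

Lemma cintegrable_hdot f g : D f -> D g ->
  cintegrable mu (fun w => hdot (H_ w) (f w) (g w)).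
Proof.
move=> /direct_integralP[mf intf] /direct_integralP[mg intg].
have [mr mi] := measurable_hdot mf mg.
have dom : mu.-integrable setT
    (fun w => (rdot_at w (f w) (f w))%:E + (rdot_at w (g w) (g w))%:E)%E.
  exact: integrableD.
have [cf _] := mf; have [cg _] := mg.
have part (h : Omega -> R) : measurable_fun setT h ->
    (forall w, `|h w| <= rdot_at w (f w) (f w) + rdot_at w (g w) (g w)) ->
    mu.-integrable setT (fun w => (h w)%:E).
  move=> mh leh; apply: le_integrable dom => //; first exact/measurable_EFinP.
  move=> w _; rewrite /= lee_fin; apply: le_trans (leh w) _; exact: ler_norm.
split; apply: part => // w.
  exact: (rdot_le_sqr (ipH w) (cf w) (cg w)).
exact: (Im_dot_le_sqr (ipH w) (cf w) (cg w)).
Qed.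

(** Products are integrable by [cintegrable_hdot], so linearity of the integral
    applies; closure under sums comes from
    [|a f + g|^2 <= 2 |a f|^2 + 2 |g|^2]. *)
Lemma direct_inner_product : inner_product D direct_dot.
Proof.
have linD (a : Cplx R) f g : D f -> D g -> D (a *: f + g).
  move=> Df Dg; have /direct_integralP[mf intf] := Df.
  have /direct_integralP[mg intg] := Dg; have mfg := mcs_lin a mf mg.
  apply/direct_integralP; split=> //.
  have dom : mu.-integrable setT (fun w =>
    ((2 * sqmod a)%:E * (rdot_at w (f w) (f w))%:E +
     2%:E * (rdot_at w (g w) (g w))%:E))%E.
    by apply: integrableD => //; apply: integrableZl.
  have [cf _] := mf; have [cg _] := mg; have [cfg _] := mfg.
  apply: le_integrable dom => //.
    by apply/measurable_EFinP; have [] := measurable_hdot mfg mfg.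
  move=> w _; rewrite /= lee_fin ger0_norm; last first.
    exact: (rdot_ge0 (ipH w) (cfg w)).
  apply: le_trans (ler_norm _).
  rewrite -[(a *: f + g) w]/(a *: f w + g w).
  have Hf := ipZ (ipH w) a (cf w).
  have := rdot_ge0 (ipH w) (ipB (ipH w) Hf (cg w)).
  have HNg := ipN (ipH w) (cg w).
  rewrite (rdotD (ipH w) Hf HNg) (rdotD (ipH w) Hf (cg w)).
  rewrite (rdotN (ipH w) (cg w)) (rdotZ (ipH w) a (cf w)).
  rewrite (rdotC (ipH w) Hf HNg) (dotNl (ipH w) (cg w) Hf) ReN.
  rewrite (rdotC (ipH w) (cg w) Hf).
  lra.
split=> //.
- apply/direct_integralP; split; first exact: mcs0.
  under eq_fun do rewrite (dot0l (ipH _) (hcar0 _)).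
  exact: integrable0.
- move=> a f g h Df Dg Dh.
  have [[cf _] _] := Df; have [[cg _] _] := Dg; have [[ch _] _] := Dh.
  rewrite /direct_dot -cintegral_lin; try exact: cintegrable_hdot.
  congr (cintegral mu _); apply/funext => w.
  exact: (ip_linl (ipH w) a (cf w) (cg w) (ch w)).
- move=> f g Df Dg; have [[cf _] _] := Df; have [[cg _] _] := Dg.
  have cj w := ip_conj (ipH w) (cf w) (cg w).
  apply: complex_eq; rewrite !partsE /=.
    by apply: eq_Rintegral => w _; rewrite cj partsE.
  have [_ ii] := cintegrable_hdot Df Dg.
  rewrite -mulN1r -RintegralZl//; apply: eq_Rintegral => w _.
  by rewrite cj partsE mulN1r.
- move=> f Df; have [[cf _] _] := Df; apply/ge0_complexP; split=> /=.
    by apply: Rintegral_ge0 => w _; exact: (rdot_ge0 (ipH w) (cf w)).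
  rewrite /Rintegral integral0_eq// => w _.
  by rewrite (Im_dot_self (ipH w) (cf w)).
Qed.

Lemma direct_dot_self f : D f ->
  (\int[mu]_w (rdot_at w (f w) (f w))%:E = (dot_norm direct_dot f ^+ 2)%:E)%E.
Proof.
move=> Df; rewrite (sqr_dot_norm direct_inner_product Df) /= /Rintegral fineK//.
by apply: integrable_fin_num => //; have /direct_integralP[] := Df.
Qed.

End DirectIntegral.

(** * Completeness of the direct integral *)

Lemma half_geometric_le (R : realType) m n :
  \sum_(m <= j < n) (2^-1 : R) ^+ j <= 2 * 2^-1 ^+ m.
Proof.
have [nm|/ltnW mn] := leqP n m; first by rewrite big_geq// mulr_ge0.
rewrite -(subnKC mn); set k := (n - m)%N.
suff -> : \sum_(m <= j < m + k) (2^-1 : R) ^+ j =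
    2 * 2^-1 ^+ m - 2 * 2^-1 ^+ (m + k).
  by rewrite gerBl mulr_ge0.
elim: k => [|k IH]; first by rewrite addn0 big_geq// subrr.
rewrite addnS big_nat_recr ?leq_addr//= IH exprS.
have two : (2 : R) * 2^-1 = 1 by rewrite divff.
by rewrite [2 * (2^-1 * _)]mulrA two mul1r; ring.
Qed.

(** The hypothesis says that the [j]-th step has length at most
    [sqrt M / 2 ^ j], and these lengths are summable. *)
Lemma geometric_steps_cauchy (R : realType) (V : lmodType R[i]) (D : set V)
    (dot : V -> V -> Cplx R) (u_ : nat -> V) (M : R) :
  inner_product D dot -> (forall n, D (u_ n)) ->
  (forall j, 4 ^+ j * complex.Re (dot (u_ j.+1 - u_ j) (u_ j.+1 - u_ j)) <= M) ->
  dot_cauchy dot u_.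
Proof.
move=> ip Du leM; pose s := Num.sqrt M.
have DB i j : D (u_ i - u_ j) by exact: (ipB ip).
have step j : dot_norm dot (u_ j.+1 - u_ j) <= s * 2^-1 ^+ j.
  rewrite exprVn ler_pdivlMr ?exprn_gt0//.
  rewrite -[leLHS]ger0_norm ?mulr_ge0 ?exprn_ge0 ?sqrtr_ge0// -sqrtr_sqr.
  apply: ler_wsqrtr; rewrite exprMn (sqr_dot_norm ip)// -exprM mulnC exprM.
  by rewrite mulrC -natrX; exact: leM.
have tail m n : (m <= n)%N -> dot_norm dot (u_ n - u_ m) <= 2 * s * 2^-1 ^+ m.
  move=> mn; rewrite -(telescope_sumr _ mn).
  apply: le_trans (dot_norm_sum ip _ _) _ => //.
  apply: (@le_trans _ _ (\sum_(m <= j < n) s * 2^-1 ^+ j)).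
    by apply: ler_sum => j _; exact: step.
  rewrite -mulr_sumr [2 * s]mulrC -mulrA; apply: ler_wpM2l.
    exact: sqrtr_ge0.
  exact: half_geometric_le.
move=> e e0.
have : geometric (2 * s) 2^-1 @ \oo --> (0 : R).
  by apply: cvg_geometric; rewrite ger0_norm// invf_lt1// ltr1n.
move/cvgrPdist_lt/(_ _ e0) => [N _ hN]; exists N.
have main m n : (N <= m)%N -> (m <= n)%N -> dot_norm dot (u_ n - u_ m) < e.
  move=> Nm mn; apply: le_lt_trans (tail _ _ mn) _.
  by have := hN _ Nm; rewrite /= sub0r normrN; apply: le_lt_trans; exact: ler_norm.
move=> m n Nm Nn; case: (leqP m n) => [mn|/ltnW nm]; last exact: main.
by rewrite (dot_normBC ip)//; apply: main.
Qed.

Section IntegralLemmas.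
Context {R : realType} {disp : measure_display} {Omega : measurableType disp}.
Variable mu : {measure set Omega -> \bar R}.

(** The sum of the [q_ j] is integrable, hence finite almost everywhere, and it
    bounds each of its terms. *)
Lemma ae_bounded (q_ : nat -> Omega -> R) (c : nat -> R) (B : R) :
  (forall j, measurable_fun setT (q_ j)) -> (forall j w, 0 <= q_ j w) ->
  (forall j, \int[mu]_w (q_ j w)%:E <= (c j)%:E)%E ->
  (forall n, \sum_(0 <= j < n) c j <= B) ->
  {ae mu, forall w, exists M, forall j, q_ j w <= M}.
Proof.
move=> mq q0 lec leB.
pose S w := (\sum_(0 <= j <oo) (q_ j w)%:E)%E.
have mS : measurable_fun setT S.
  apply: ge0_emeasurable_sum => [k w _ _|k _]; first by rewrite lee_fin.
  exact/measurable_EFinP.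
have S0 w : (0 <= S w)%E by apply: nneseries_ge0 => k _ _; rewrite lee_fin.
have intS : mu.-integrable setT S.
  apply/integrableP; split=> //.
  under eq_integral do rewrite gee0_abs//.
  rewrite integral_nneseries//; first last.
  - by move=> k w _; rewrite lee_fin.
  - by move=> k; exact/measurable_EFinP.
  apply: (@le_lt_trans _ _ B%:E); last exact: ltry.
  apply: lime_le.
    by apply: is_cvg_nneseries => k _ _; apply: integral_ge0 => w _; rewrite lee_fin.
  apply: nearW => n; apply: (@le_trans _ _ (\sum_(0 <= j < n) (c j)%:E)%E).
    by apply: lee_sum.
  by rewrite sumEFin lee_fin.
have := integrable_ae measurableT intS; apply: filterS => w /(_ I) Sw.
exists (fine (S w)) => j; rewrite -lee_fin fineK//.
apply: le_trans (nneseries_lim_ge j.+1 _); last by move=> k _ _; rewrite lee_fin.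
rewrite big_nat_recr//= leeDr// sume_ge0// => k _.
by rewrite lee_fin.
Qed.

(** Fatou's lemma in the form needed to bound the distance to an almost
    everywhere limit. *)
Lemma fatou_bound (q_ : nat -> Omega -> R) (q : Omega -> R) (c : R) :
  (forall j, measurable_fun setT (q_ j)) -> (forall j w, 0 <= q_ j w) ->
  measurable_fun setT q -> (forall w, 0 <= q w) ->
  {ae mu, forall w, (fun j => q_ j w) @ \oo --> q w} ->
  (\forall j \near \oo, \int[mu]_w (q_ j w)%:E <= c%:E)%E ->
  (\int[mu]_w (q w)%:E <= c%:E)%E.
Proof.
move=> mq_ q_0 mq q0 aeq lec.
have meq_ j : measurable_fun setT (fun w => (q_ j w)%:E) by exact/measurable_EFinP.
have ge0_ j w : setT w -> (0 <= (q_ j w)%:E)%E by rewrite lee_fin.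
apply: (@le_trans _ _ (\int[mu]_w limn_einf (fun j => (q_ j w)%:E))%E).
  apply: ae_ge0_le_integral => //.
  - by move=> w _; rewrite lee_fin.
  - exact/measurable_EFinP.
  - move=> w _; rewrite limn_einf_lim; apply: lime_ge; first exact: is_cvg_einfs.
    by apply: nearW => n; apply: le_ereal_inf_tmp => _ [m _ <-]; rewrite lee_fin.
  - rewrite (_ : (fun w => _) = (fun w => - limn_esup (fun j => - (q_ j w)%:E))%E).
      apply: measurableT_comp => //; apply: measurable_fun_limn_esup => j.
      exact: measurableT_comp.
    by apply/funext => w; rewrite -[RHS]/(- limn_esup (-%E \o (fun j => (q_ j w)%:E)))%E
      limn_esupN oppeK.
  apply: filterS aeq => w qw _.
  have qwE : (fun j => (q_ j w)%:E) @ \oo --> (q w)%:E.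
    by apply: cvg_EFin => //; exact: nearW.
  by rewrite (cvg_limn_einf_sup qwE).1.
apply: le_trans (fatou mu measurableT meq_ ge0_) _.
rewrite limn_einf_lim; apply: lime_le; first exact: is_cvg_einfs.
apply: filterS lec => n; apply: le_trans.
by apply: ereal_inf_lbound; exists n => /=.
Qed.

End IntegralLemmas.

Section Completeness.
Context {R : realType} {X : Type}.
Context {disp : measure_display} {Omega : measurableType disp}.
Context {mu : {measure set Omega -> \bar R}} {d : option nat}.
Context {H_ : Omega -> hilbert (X -> Cplx R)}.
Context {E : Omega -> (X -> Cplx R) -> nat -> Cplx R}.
Hypothesis E_isometry : forall w, linear_isometry_Cd d (H_ w) (E w).

Local Notation D := (direct_integral mu d H_ E).
Local Notation mcs := (measurable_cross_section d H_ E).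
Local Notation rdot_at w u v := (complex.Re (hdot (H_ w) u v)).
Local Notation ipH w := (hilbert_inner_product (H_ w)).
Local Notation ipD := (direct_inner_product (mu := mu) E_isometry).
Local Notation norm := (dot_norm (direct_dot (mu := mu) (H_ := H_))).

(** The isometries turn convergence in the fibres into convergence of each
    coordinate, so the coordinates of [l] are measurable off [B], and they vanish
    on [B]. *)
Lemma mcs_limit (f_ : nat -> Omega -> X -> Cplx R) (l : Omega -> X -> Cplx R)
    (B : set Omega) : measurable B -> (forall j, mcs (f_ j)) ->
  cross_section H_ l -> (forall w, B w -> l w = 0) ->
  (forall w, ~ B w -> dot_cvg (hdot (H_ w)) (fun j => f_ j w) (l w)) -> mcs l.
Proof.
move=> mB mf cl l0 fl; apply/(mcsP E_isometry); split=> // k.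
have cf j : cross_section H_ (f_ j) by have [] := mf j.
have bound j w : Cd_norm (E w (f_ j w) - E w (l w)) =
    dot_norm (hdot (H_ w)) (f_ j w - l w).
  have [_ linE normE] := E_isometry w.
  rewrite -normE; last exact: (ipB (ipH w) (cf j w) (cl w)).
  have := linE (-1) (l w) (f_ j w) (cl w) (cf j w).
  by rewrite !scaleN1r addrC => ->; rewrite addrC.
have CE w u : hcar (H_ w) u -> Cd d (E w u) by have [CE _ _] := E_isometry w; exact: CE.
have part (F : Cplx R -> R) : F 0 = 0 ->
    (forall u v : nat -> Cplx R, Cd d u -> Cd d v ->
      `|F (u k) - F (v k)| <= Cd_norm (u - v)) ->
    (forall j, measurable_fun setT (fun w => F (E w (f_ j w) k))) ->
    measurable_fun setT (fun w => F (E w (l w) k)).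
  move=> F0 FB mF.
  apply: (@measurable_fun_cvg _ _ _ _
    (fun j w => \1_(~` B) w * F (E w (f_ j w) k))) => [j|w _].
    apply: measurable_funM => //; apply: measurable_indic; exact: measurableC.
  have [Bw|nBw] := pselect (B w).
    rewrite l0// (isometry0 (E_isometry w)) F0; apply: cvg_near_cst.
    by apply: nearW => j; rewrite indicE memNset ?mul0r//; apply.
  apply/cvgrPdist_lt => e e0.
  move/dot_cvgP/(_ _ e0): (fl w nBw) => [N hN]; exists N => // j /= Nj.
  rewrite indicE mem_set// mul1r distrC; apply: le_lt_trans (hN j Nj).
  by rewrite -bound; apply: FB; apply: CE; [exact: cf|exact: cl].
have mc j := (proj1 (mcsP E_isometry (f_ j)) (mf j)).2 k.
have CB (u v : nat -> Cplx R) : Cd d u -> Cd d v -> Cd d (u - v).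
  exact: (ipB Cd_inner_product).
split; apply: part => // [u v Cu Cv|j].
- have [+ _] := Cd_coord_le k (CB _ _ Cu Cv).
  by rewrite -[(u - v) k]/(u k - v k) ReD ReN.
- exact: (mc j).1.
- have [_ +] := Cd_coord_le k (CB _ _ Cu Cv).
  by rewrite -[(u - v) k]/(u k - v k) ImD ImN.
- exact: (mc j).2.
Qed.

(** A Cauchy sequence has a subsequence whose consecutive distances decrease
    geometrically; it is Cauchy in almost every fibre, and Fatou's lemma turns
    its fibrewise limit into a limit of the whole sequence. *)
Lemma direct_integral_complete :
  dot_complete D (direct_dot (mu := mu) (H_ := H_)).
Proof.
move=> f_ Df f_cauchy.
have mf n : mcs (f_ n) by have [] := Df n.
have cf n w : hcar (H_ w) (f_ n w) by have [] := mf n.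
have DB m n : D (f_ m - f_ n) := ipB ipD (Df m) (Df n).
have mdist g h : mcs g -> mcs h -> mcs (g - h).
  move=> mg mh; have := mcs_lin E_isometry (-1) mh mg.
  by rewrite scaleN1r addrC.
have [Nf hNf] : exists Nf : nat -> nat, forall j m n,
    (Nf j <= m)%N -> (Nf j <= n)%N -> norm (f_ m - f_ n) < 4^-1 ^+ j.
  have /choice[Nf hNf] : forall j, exists N : nat, forall m n,
    (N <= m)%N -> (N <= n)%N -> norm (f_ m - f_ n) < 4^-1 ^+ j.
    by move=> j; apply: f_cauchy; rewrite exprn_gt0// invr_gt0.
  by exists Nf.
(* Summing makes phi monotone, and the successors make it exceed j. *)
pose phi j := (\sum_(0 <= i < j.+1) (Nf i).+1)%N.
have phiS j : phi j.+1 = (phi j + (Nf j.+1).+1)%N by rewrite /phi big_nat_recr.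
have Nphi j : (Nf j <= phi j)%N.
  case: j => [|j]; first by rewrite /phi big_nat1.
  by rewrite phiS; apply: leq_trans (leqnSn _) (leq_addl _ _).
have jphi j : (j <= phi j)%N.
  by elim: j => // j IH; rewrite phiS addnS ltnS (leq_trans IH)// leq_addr.
pose step j : Omega -> X -> Cplx R := f_ (phi j.+1) - f_ (phi j).
have mstep j : mcs (step j) by exact: mdist.
have Dstep j : D (step j) by exact: DB.
(* The squared steps have integrals at most 4^(-2j), so that the weights 4^j
   still leave a convergent series. *)
have [B [mB B0 hB]] : {ae mu, forall w, exists M, forall j,
    4 ^+ j * rdot_at w (step j w) (step j w) <= M}.
  apply: (@ae_bounded _ _ _ _ _ (fun j => 2^-1 ^+ j) 2) => [j|j w|j|n].
  - apply: measurable_funM => //.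
    by have [] := measurable_hdot E_isometry (mstep j) (mstep j).
  - rewrite mulr_ge0 ?exprn_ge0//; apply: (rdot_ge0 (ipH w)).
    by have [] := mstep j.
  - have int := (proj1 (direct_integralP E_isometry (step j)) (Dstep j)).2.
    under eq_integral do rewrite EFinM.
    rewrite integralZl// (direct_dot_self E_isometry)// -EFinM lee_fin.
    have small : norm (step j) <= 4^-1 ^+ j.
      apply/ltW/hNf => //; rewrite phiS; exact: leq_trans (Nphi j) (leq_addr _ _).
    apply: (@le_trans _ _ (4 ^+ j * (4^-1 ^+ j) ^+ 2)).
      apply: ler_wpM2l; first by rewrite exprn_ge0.
      by apply: lerXn2r => //; rewrite nnegrE ?sqrtr_ge0 ?exprn_ge0 ?invr_ge0.
    rewrite expr2 mulrA -exprMn divff// expr1n mul1r.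
    by apply: lerXn2r; rewrite ?nnegrE ?invr_ge0// lef_pV2 ?posrE// ler_nat.
  - by apply: le_trans (half_geometric_le _ _ _) _; rewrite expr0 mulr1.
have good w : ~ B w -> exists M, forall j,
    4 ^+ j * rdot_at w (step j w) (step j w) <= M.
  by move=> nBw; apply: contrapT => /hB.
have /choice[l hl] : forall w, exists lw, [/\ hcar (H_ w) lw, (B w -> lw = 0) &
    (~ B w -> dot_cvg (hdot (H_ w)) (fun j => f_ (phi j) w) lw)].
  move=> w; have [Bw|nBw] := pselect (B w).
    by exists 0; split=> //; exact: hcar0.
  have [M leM] := good w nBw.
  have [lw Hlw lim] := hcomplete (fun j => cf (phi j) w)
    (geometric_steps_cauchy (ipH w) (fun j => cf (phi j) w) leM).
  by exists lw; split.
have cl : cross_section H_ l by move=> w; have [] := hl w.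
have ml : mcs l.
  apply: (@mcs_limit (fun j => f_ (phi j)) l B) => // w; by have [] := hl w.
have dist_le e : 0 < e -> exists N, forall n, (N <= n)%N ->
    (\int[mu]_w (rdot_at w ((f_ n - l) w) ((f_ n - l) w))%:E <= (e ^+ 2)%:E)%E.
  move=> e0; have [N hN] := f_cauchy e e0; exists N => n Nn.
  have mfl := mdist _ _ (mf n) ml.
  apply: (@fatou_bound _ _ _ _ (fun j w => rdot_at w
      ((f_ n - f_ (phi j)) w) ((f_ n - f_ (phi j)) w))) => [j|j w||w||].
  - have mfj := mdist _ _ (mf n) (mf (phi j)).
    by have [] := measurable_hdot E_isometry mfj mfj.
  - exact: (rdot_ge0 (ipH w) (ipB (ipH w) (cf n w) (cf (phi j) w))).
  - by have [] := measurable_hdot E_isometry mfl mfl.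
  - exact: (rdot_ge0 (ipH w) (ipB (ipH w) (cf n w) (cl w))).
  - exists B; split=> // w /= nlim; apply: contrapT => nBw; apply: nlim.
    have [_ _ /(_ nBw) lim] := hl w.
    exact: (cvg_dist_sqr (ipH w) (cf n w) (fun j => cf (phi j) w) (cl w) lim).
  - exists N => // j /= Nj; rewrite (direct_dot_self E_isometry)// lee_fin.
    apply: lerXn2r; rewrite ?nnegrE ?sqrtr_ge0 ?ltW//.
    by apply: hN => //; exact: leq_trans Nj (jphi j).
have Dfl e : 0 < e -> exists N, forall n, (N <= n)%N ->
    D (f_ n - l) /\ norm (f_ n - l) <= e.
  move=> e0; have [N hN] := dist_le e e0; exists N => n Nn.
  have mfl := mdist _ _ (mf n) ml; have lee := hN n Nn.
  have Dnl : D (f_ n - l).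
    split=> //; apply: le_lt_trans (ltry (e ^+ 2)); apply: le_trans lee.
    rewrite le_eqVlt; apply/orP; left; apply/eqP; apply: eq_integral => w _.
    by rewrite (sqr_dot_norm (ipH w))//; have [] := mfl.
  split=> //; move: lee; rewrite (direct_dot_self E_isometry)// lee_fin.
  by rewrite ler_pXn2r// nnegrE ?sqrtr_ge0 ?(ltW e0).
have Dl : D l.
  have [N hN] := Dfl 1 ltr01; have [DN _] := hN N (leqnn N).
  by rewrite -[l](subKr (f_ N)); exact: (ipB ipD).
exists l => //; apply/dot_cvgP => e e0.
have e2 : 0 < e / 2 by rewrite divr_gt0.
have [N hN] := Dfl _ e2; exists N => n Nn; have [_] := hN n Nn.
by move=> /le_lt_trans; apply; rewrite ltr_pdivrMr// ltr_pMr// ltr1n.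
Qed.

End Completeness.

(** * Identification of the direct integral with square integrable maps *)

Section NullSections.
Context {R : realType} {X : Type}.
Context {disp : measure_display} {Omega : measurableType disp}.
Context {mu : {measure set Omega -> \bar R}} {d : option nat}.
Context {H_ : Omega -> hilbert (X -> Cplx R)}.
Context {E : Omega -> (X -> Cplx R) -> nat -> Cplx R}.
Hypothesis E_isometry : forall w, linear_isometry_Cd d (H_ w) (E w).

Local Notation D := (direct_integral mu d H_ E).
Local Notation ipH w := (hilbert_inner_product (H_ w)).
Local Notation norm := (dot_norm (direct_dot (mu := mu) (H_ := H_))).

Lemma direct_integral_L2 f : D f -> L2_Cd mu d (fun w => E w (f w)).
Proof.
move=> [[cf mf] fin]; split=> //; apply: le_lt_trans fin.
rewrite le_eqVlt; apply/orP; left; apply/eqP; apply: eq_integral => w _.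
by have [_ _ ->] := E_isometry w.
Qed.

Lemma L2_Cd_dotE f g : D f -> D g ->
  L2_Cd_dot mu (fun w => E w (f w)) (fun w => E w (g w)) =
  direct_dot (mu := mu) (H_ := H_) f g.
Proof.
move=> [[cf _] _] [[cg _] _]; congr (cintegral mu _); apply/funext => w.
exact: (isometry_dot (E_isometry w) (cf w) (cg w)).
Qed.

(** A nonnegative function has integral zero only if it vanishes almost
    everywhere; here the function is [|f_w|^2 = |E_w f_w|^2]. *)
Lemma L2_Cd_nullP f : D f ->
  L2_Cd_null mu (fun w => E w (f w)) <-> norm f = 0.
Proof.
move=> Df; have [[cf _] _] := Df.
have [mf int] := proj1 (direct_integralP E_isometry f) Df.
have q0 w : 0 <= complex.Re (hdot (H_ w) (f w) (f w)) := rdot_ge0 (ipH w) (cf w).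
have qE w : complex.Re (hdot (H_ w) (f w) (f w)) = 0 <-> E w (f w) = 0.
  split=> [h|h].
    suff -> : f w = 0 by exact: (isometry0 (E_isometry w)).
    by apply: (hdot_eq0 (cf w)); rewrite (dot_selfE (ipH w) (cf w)) h.
  rewrite -(isometry_dot (E_isometry w) (cf w) (cf w)) h.
  by rewrite (dot0l (@Cd_inner_product R d))//; exact: Cd0.
have aeE := ae_eq_integral_abs mu measurableT (measurable_int _ int).
have absE : (\int[mu]_w `|(complex.Re (hdot (H_ w) (f w) (f w)))%:E| =
    (norm f ^+ 2)%:E)%E.
  rewrite -(direct_dot_self E_isometry Df); apply: eq_integral => w _.
  by rewrite gee0_abs// lee_fin.
rewrite absE in aeE; split=> [nul|f0].
  suff /aeE[/eqP] : ae_eq mu setT (fun w =>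
      (complex.Re (hdot (H_ w) (f w) (f w)))%:E) (cst 0%E).
    by rewrite sqrf_eq0 => /eqP.
  by apply: filterS nul => w /qE -> _.
have /aeE : (norm f ^+ 2)%:E = 0%E by rewrite f0 expr0n.
by apply: filterS => w /(_ I)[/qE].
Qed.

End NullSections.

(** * The sampling formula *)

Theorem proposition5p1 (R : realType) (X : Type)
    (disp : measure_display) (Omega : measurableType disp)
    (mu : {measure set Omega -> \bar R}) (d : option nat)
    (H_ : Omega -> hilbert (X -> Cplx R))
    (K_ : Omega -> X -> X -> Cplx R)
    (E : Omega -> (X -> Cplx R) -> nat -> Cplx R)
    (H_kernel : forall w, reproducing_kernel (H_ w) (K_ w))
    (H_dim : forall w, hilbert_dim (H_ w) d)
    (E_isometry : forall w, linear_isometry_Cd d (H_ w) (E w))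
    (K_measurable : forall x,
      measurable_cross_section d H_ E (fun w => (K_ w)^~ x))
    (K_integrable : forall x,
      (\int[mu]_w (complex.Re (K_ w x x))%:E < +oo)%E)
    (H : hilbert (X -> Cplx R)) (K : X -> X -> Cplx R)
    (K_def : forall x y, K x y = cintegral mu (fun w => K_ w x y))
    (HK : reproducing_kernel H K)
    (y : nat -> X)
    (y_complete : complete_orthogonal_set (L2_Cd mu d) (L2_Cd_null mu)
      (L2_Cd_dot mu) (fun n w => E w ((K_ w)^~ (y n)))) :
  [/\ hcar H = [set g | exists2 f, direct_integral mu d H_ E f &
                  g = fun x => cintegral mu (fun w => f w x)],
      complete_orthogonal_set (hcar H) [set 0] (hdot H)
        (fun n => K^~ (y n)) &
      forall g, hcar H g -> forall x,
        series (fun n => g (y n) * (K x (y n) / K (y n) (y n)) : Cplx R)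
          @ \oo --> (g x : Cplx R)].
Proof.
pose kap (x : X) : Omega -> X -> Cplx R := fun w => (K_ w)^~ x.
pose D := direct_integral mu d H_ E.
pose ddot := direct_dot (mu := mu) (H_ := H_).
have ipD : inner_product D ddot := direct_inner_product E_isometry.
have D_complete : dot_complete D ddot := direct_integral_complete E_isometry.
have ipH := hilbert_inner_product H.
have H_complete : dot_complete (hcar H) (hdot H) := @hcomplete _ _ H.
have Dkap x : D (kap x).
  split; first exact: K_measurable.
  apply: le_lt_trans (K_integrable x); rewrite le_eqVlt.
  apply/orP; left; apply/eqP; apply: eq_integral => w _.
  have [Hx repr] := H_kernel w x.
  by rewrite (sqr_dot_norm (hilbert_inner_product (H_ w)) Hx) -repr.
have HKx x : hcar H (K^~ x) by have [] := HK x.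
have ddot_kap f x : D f -> ddot f (kap x) = cintegral mu (fun w => f w x).
  move=> [[cf _] _]; congr (cintegral mu _); apply/funext => w.
  by have [_ /(_ _ (cf w)) <-] := H_kernel w x.
have hdot_K g x : hcar H g -> hdot H g (K^~ x) = g x.
  by move=> Hg; have [_ /(_ _ Hg) <-] := HK x.
have gram x z : ddot (kap x) (kap z) = hdot H (K^~ x) (K^~ z).
  by rewrite ddot_kap// hdot_K// K_def.
have [_ y_nonnull y_orth y_total] := y_complete.
have dotE f g : D f -> D g ->
    L2_Cd_dot mu (fun w => E w (f w)) (fun w => E w (g w)) = ddot f g.
  exact: L2_Cd_dotE.
have kap_orth m n : m <> n -> ddot (kap (y m)) (kap (y n)) = 0.
  by move=> mn; rewrite -dotE//; exact: y_orth.
have kap_neq0 n : ddot (kap (y n)) (kap (y n)) != 0.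
  apply/eqP => n0; apply: (y_nonnull n).
  apply/(L2_Cd_nullP E_isometry (Dkap (y n))).
  by rewrite /dot_norm -/ddot n0 sqrtr0.
have kap_total f : D f -> (forall n, ddot f (kap (y n)) = 0) ->
    dot_norm ddot f = 0.
  move=> Df f0; apply/(L2_Cd_nullP E_isometry Df); apply: y_total.
    exact: direct_integral_L2.
  by move=> n; rewrite (dotE f (kap (y n)) Df (Dkap _)).
have expandD f (Df : D f) := fourier_series_cvg ipD (fun n => Dkap (y n))
  kap_orth kap_neq0 D_complete kap_total Df.
have K_orth m n : m <> n -> hdot H (K^~ (y m)) (K^~ (y n)) = 0.
  by rewrite -gram; exact: kap_orth.
have K_neq0 n : hdot H (K^~ (y n)) (K^~ (y n)) != 0 by rewrite -gram.
(* The limit of the transferred series is a function with the same products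
   with all K(., z) as K(., x), hence it is K(., x). *)
have expandK x : dot_cvg (hdot H) (fun n => \sum_(0 <= i < n)
    fourier (dot := ddot) (v := fun n => kap (y n)) (kap x) i *: K^~ (y i))
    (K^~ x).
  have [h [Hh hlim hx]] := gram_transfer ipD ipH Dkap HKx gram H_complete
    (Dkap x) (expandD _ (Dkap x)).
  suff <- : h = K^~ x by [].
  by apply/funext => z; rewrite -hdot_K// hx gram hdot_K.
have K_total g : hcar H g -> (forall n, hdot H g (K^~ (y n)) = 0) -> g = 0.
  move=> Hg g0; apply/funext => x.
  have Hsum n : hcar H (\sum_(0 <= i < n)
      fourier (dot := ddot) (v := fun n => kap (y n)) (kap x) i *: K^~ (y i)).
    by apply: (ip_sum ipH) => i; apply: (ipZ ipH).
  have h1 := cvg_dotl ipH Hsum (HKx x) Hg (expandK x).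
  have h2 : (fun n => hdot H (\sum_(0 <= i < n) fourier (dot := ddot)
      (v := fun n => kap (y n)) (kap x) i *: K^~ (y i)) g) @ \oo --> (0 : Cplx R).
    apply: cvg_near_cst; apply: nearW => n.
    rewrite (dot_suml ipH)//; last by move=> i; apply: (ipZ ipH).
    rewrite big1// => i _; rewrite (dotZl ipH)// (ip_conj ipH Hg)// g0.
    by rewrite conjC0 mulr0.
  rewrite -(hdot_K _ _ Hg) (ip_conj ipH (HKx x) Hg).
  by rewrite (cvg_unique _ h1 h2) ?conjC0//; exact: norm_hausdorff.
have expandH g (Hg : hcar H g) := fourier_series_cvg ipH (fun n => HKx (y n))
  K_orth K_neq0 H_complete (fun u Hu u0 =>
    etrans (congr1 _ (K_total u Hu u0)) (dot_norm0 ipH)) Hg.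
split.
- apply/seteqP; split=> [g Hg|g [f Df ->]].
    have [f [Df _ fx]] := gram_transfer ipH ipD HKx Dkap
      (fun x z => esym (gram x z)) D_complete Hg (expandH g Hg).
    exists f => //; apply/funext => x.
    by rewrite -ddot_kap// fx hdot_K.
  have [h [Hh _ hx]] := gram_transfer ipD ipH Dkap HKx gram H_complete Df
    (expandD f Df).
  suff -> : (fun x => cintegral mu (fun w => f w x)) = h by [].
  by apply/funext => x; rewrite -ddot_kap// -hx hdot_K.
- split=> // n /= Kn; move/eqP: (K_neq0 n).
  by rewrite Kn (dot0l ipH)//; exact: (ip0 ipH).
move=> g Hg x.
have Hsum n : hcar H (\sum_(0 <= i < n)
    fourier (dot := hdot H) (v := fun n => K^~ (y n)) g i *: K^~ (y i)).
  by apply: (ip_sum ipH) => i; apply: (ipZ ipH).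
have := cvg_dotl ipH Hsum Hg (HKx x) (expandH g Hg).
rewrite hdot_K//; apply: cvg_trans; apply: near_eq_cvg; apply: nearW => n.
rewrite seriesEnat /= (dot_suml ipH)//; last by move=> i; apply: (ipZ ipH).
apply: eq_bigr => i _; rewrite (dotZl ipH)// /fourier !hdot_K//.
by rewrite mulrAC mulrA.
Qed.
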